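(* Let $q\in(0,2]$. For $\beta>0$ let $p=1-e^{-\beta}$ and let $\pi_n(\beta)$ be the connection probability between the root and the leaves of $T_n$ for the random cluster model with parameters $(p,q)$ and wired boundary condition, on a quenched Galton--Watson tree; let $\pi(\beta):=\lim_{n\to\infty}\pi_n(\beta)$ (which exists by monotonicity). Let $\beta_c$ be defined by the relation $m\,\psi_q(\beta_c)=1$, with $\psi_q(x)=\frac{e^x-1}{e^x+q-1}$. Then, in $\mathbf P$-probability, $$\lim_{n\to\infty}\pi_n(\beta)=0\ \text{ if }\beta\le\beta_c\qquad\text{and}\qquad\liminf_{n\to\infty}\pi_n(\beta)>0\ \text{ if }\beta>\beta_c.$$ In particular, $\pi(\beta)>0$ if and only if $\beta>\beta_c$ ($\mathbf P$-almost surely, for each fixed $\beta$).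
   Context: Tree. $\mu$ is a probability distribution on $\{0,1,2,\dots\}$ with $\mu(0)=0$, $\mu(1)<1$; $Z\sim\mu$ and $m:=\mathbf E[Z]<\infty$ (so $m>1$). $T$ is the Galton--Watson tree with offspring law $\mu$ and root $\rho$; $T_n$ is the subtree of vertices at distance at most $n$ from the root, and $\partial T_n$ is the set of vertices at distance exactly $n$. $\mathbf P$ is the law of the tree. Random cluster model. For a finite (multi)graph $G=(V,E)$, $p\in[0,1]$ and $q>0$, $\mathbb P^G_{p,q}(\omega)=\frac1{Z^G_{p,q}}p^{o(\omega)}(1-p)^{f(\omega)}q^{k(\omega)}$ for $\omega\in\{0,1\}^E$, where $o(\omega)$, $f(\omega)$ are the numbers of open ($\omega_e=1$) and closed ($\omega_e=0$) edges, $k(\omega)$ is the number of connected components (on the vertex set $V$) formed by the open edges, and $Z^G_{p,q}$ is the normalizing constant. Wired boundary condition: $\bar T_n$ is the graph obtained from $T_n$ by identifying all vertices of $\partial T_n$ to a single vertex, and $\pi_n(\beta)=\mathbb P^{\bar T_n}_{p,q}(\rho\leftrightarrow\partial T_n)$ is the probability that $\rho$ is connected to this vertex by open edges. It is a random variable, function of the tree $T_n$. The statement $\liminf_n\pi_n(\beta)>0$ in $\mathbf P$-probability means $\lim_{\varepsilon\downarrow0}\limsup_{n\to\infty}\mathbf P(\pi_n(\beta)\le\varepsilon)=0$. *)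

(* Defs.v *)
From HB Require Import structures.
From mathcomp Require Import all_boot all_order all_algebra.
From mathcomp Require Import all_classical all_reals all_analysis.
From mathcomp Require Import ring lra.

Set Implicit Arguments.
Unset Strict Implicit.
Unset Printing Implicit Defensive.

Import Order.TTheory GRing.Theory Num.Theory.
Import numFieldNormedType.Exports.

Local Open Scope ring_scope.

(* Finite multigraphs: parallel edges and loops are allowed, and the order of
   the two endpoints of an edge is immaterial. *)
Record mgraph := MGraph {
  vert : finType;
  edge : finType;
  ends : edge -> vert * vert
}.

(* The graph obtained from G by identifying all the vertices of A: the merged
   vertex is None, a vertex x outside A is Some x, and the edge set is unchanged.
   This is the quotient of G as soon as A is nonempty; when A is empty, None is
   an additional isolated vertex. *)
Definition proj_vert (G : mgraph) (A : {set vert G}) (x : vert G) :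
  option {y : vert G | y \notin A} := insub x.

Definition identify (G : mgraph) (A : {set vert G}) : mgraph :=
  @MGraph (option {y : vert G | y \notin A}) (edge G)
    (fun e => (proj_vert A (ends e).1, proj_vert A (ends e).2)).

Section RandomCluster.
Variables (R : realFieldType) (G : mgraph) (p q : R).
Implicit Types w : {ffun edge G -> bool}.

Definition open_adj w : rel (vert G) := fun x y =>
  [exists e, w e && ((ends e == (x, y)) || (ends e == (y, x)))].

Definition n_open w : nat := #|[set e | w e]|.
Definition n_closed w : nat := #|[set e | ~~ w e]|.
Definition n_clusters w : nat := n_comp (open_adj w) predT.

Definition rc_weight w : R :=
  p ^+ n_open w * (1 - p) ^+ n_closed w * q ^+ n_clusters w.

Definition rc_partition : R := \sum_w rc_weight w.

Definition rc_prob (A : pred {ffun edge G -> bool}) : R :=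
  \sum_(w | A w) rc_weight w / rc_partition.

Definition rc_connect (x y : vert G) : R :=
  rc_prob (fun w => connect (open_adj w) x y).

End RandomCluster.

(* Trees in Ulam-Harris coding, with words written from the vertex down to the
   root: the root is [::], the children of v are i :: v for i < N v, and the
   parent of v is behead v. The offspring numbers N are given on all words, only
   those at vertices of the tree being used. *)
Section Tree.
Variable N : seq nat -> nat.

Fixpoint generation (n : nat) : seq (seq nat) :=
  if n is k.+1 then [seq i :: v | v <- generation k, i <- iota 0 (N v)]
  else [:: [::]].

Definition tree_vertices (n : nat) : seq (seq nat) :=
  flatten [seq generation k | k <- iota 0 n.+1].

Lemma root_in_tree n : [::] \in tree_vertices n.
Proof. by rewrite /tree_vertices /= inE eqxx. Qed.

Lemma parent_in_tree n v : v \in tree_vertices n -> behead v \in tree_vertices n.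
Proof.
case/flattenP => s /mapP[k]; rewrite mem_iota add0n => /andP[_ ltkn] ->.
case: k ltkn => [|k] ltkn; first by rewrite inE => /eqP ->; apply: root_in_tree.
case/allpairsPdep=> u [i [uk _ ->]] /=; apply/flattenP.
exists (generation k) => //; apply/mapP; exists k => //.
by rewrite mem_iota add0n; apply: ltnW.
Qed.

Definition tree_vert (n : nat) : finType := seq_sub (tree_vertices n).

Definition tree_root (n : nat) : tree_vert n := SeqSub (root_in_tree n).

Definition tree_parent (n : nat) (v : tree_vert n) : tree_vert n :=
  SeqSub (parent_in_tree (ssvalP v)).

(* Each edge is indexed by its lower endpoint. *)
Definition tree_graph (n : nat) : mgraph :=
  @MGraph (tree_vert n) {v : tree_vert n | ssval v != [::]}
    (fun e => (tree_parent (val e), val e)).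

Definition tree_leaves (n : nat) : {set vert (tree_graph n)} :=
  [set v | size (ssval v) == n].

Definition wired_tree (n : nat) : mgraph := identify (tree_leaves n).

(* The probability that the root is connected to the merged leaves. For n = 0
   the root is itself the merged vertex. *)
Definition conn_prob (R : realType) (q beta : R) (n : nat) : R :=
  @rc_connect R (wired_tree n) (1 - expR (- beta)) q
    (proj_vert (tree_leaves n) (tree_root n)) None.

End Tree.

Definition psi (R : realType) (q x : R) : R :=
  (expR x - 1) / (expR x + q - 1).

(* The relation m * psi q b = 1 determines b. *)
Lemma psi_eq1_unique (R : realType) (q m : R) : 0 < q -> 1 < m ->
  exists! b : R, m * psi q b = 1.
Proof.
move=> q0 m1; have m10 : m - 1 != 0 by rewrite subr_eq0 gt_eqF.
have y0 : 0 < 1 + q / (m - 1) by rewrite addr_gt0 ?divr_gt0 ?subr_gt0.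
exists (ln (1 + q / (m - 1))); split=> [|b].
  rewrite /psi lnK ?posrE //; field; rewrite m10 /=.
  rewrite [X in X != 0](_ : _ = q * m); last by ring.
  by rewrite mulf_neq0 ?gt_eqF // (lt_trans ltr01).
rewrite /psi; have [->|nz] := eqVneq (expR b + q - 1) 0.
  by rewrite invr0 !mulr0 => /esym/eqP; rewrite oner_eq0.
rewrite mulrA => /(canRL (mulfVK nz)); rewrite mul1r => e.
rewrite -[b]expRK; congr ln; apply: (mulIf m10).
rewrite mulrDl mulfVK //; lra.
Qed.

Section Probability.
Context d (Omega : measurableType d) (R : realType) (P : probability Omega R).
Local Open Scope classical_set_scope.
Local Open Scope ereal_scope.

Definition mutually_independent (I : eqType) d' (T : measurableType d')
    (X : I -> {RV P >-> T}) : Prop :=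
  forall (s : seq I) (A : I -> set T), uniq s -> (forall i, measurable (A i)) ->
    P (\bigcap_(i in [set` s]) (X i @^-1` A i)) =
    \prod_(i <- s) P (X i @^-1` A i).

(* N is the family of offspring numbers of a Galton-Watson tree with offspring
   law mu. *)
Definition GW_offspring (mu : probability nat R)
    (N : seq nat -> {RV P >-> nat}) : Prop :=
  mutually_independent N /\
  forall v A, measurable A -> distribution P (N v) A = mu A.

Definition cvg_in_probability (X : nat -> Omega -> R) (l : R) : Prop :=
  forall eps : R, (0 < eps)%R ->
    P [set w | (eps <= `|X n w - l|)%R] @[n --> \oo] --> 0.

Definition liminf_gt0_in_probability (X : nat -> Omega -> R) : Prop :=
  limn_esup (fun n => P [set w | (X n w <= eps)%R]) @[eps --> (0%R : R)^'+] --> 0.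

End Probability.

(* Main.v *)
Require Import Defs.
From mathcomp Require Import all_boot all_order all_algebra.
From mathcomp Require Import all_classical all_reals all_analysis.
From mathcomp Require Import measurable_realfun.
From mathcomp Require Import ring lra.
Import Order.TTheory GRing.Theory Num.Theory.
Import numFieldNormedType.Exports.
Set Implicit Arguments.
Unset Strict Implicit.
Unset Printing Implicit Defensive.
Local Open Scope ring_scope.

(** On a tree the random cluster measure is solved by a recursion. Let B be the
    exponential of beta. A cluster that misses the leaves is a subtree hanging from
    its top vertex, so the weight of a configuration is a product over vertices, and
    the partition functions of the subtree of v, restricted to v reaching or missing
    the leaves (Zhit and Zmiss), factorize over the children of v. Hence the ratio
    X(v) = (Zhit + Zmiss) / Zmiss is the product over the children i of v of
    edge_map B q (X(i)), where

      edge_map B q X = (B X + q - 1) / (X + B + q - 2),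

    a concave function fixing 1 with derivative psi q beta at 1 (edge_ratioE). The
    connection probability is an increasing function of the edge_map of the ratio at
    the root, vanishing when that ratio is 1 (conn_probE). The ratio decreases with
    the depth and increases with the tree, so the limit exists, and everything
    reduces to whether the ratio at the root converges to 1. Linearizing at 1, each
    generation multiplies deviations from 1 by m psi, which is at most 1 exactly
    when beta is at most beta_c (slope_critical).

    If m psi <= 1, take the transform phi(X) = (X - 1) / (X + 1). For q at most 2
    an edge multiplies it by at most psi (half_tanh_edge_map), and on products it is
    subadditive with a defect of order phi(X)^2 phi(Y) (half_tanhM). The
    independence of two siblings turns that defect into a cubic term: the mean l of
    phi at depth n satisfies l(n + 1) <= l(n) - c l(n)^3, with c > 0 because some
    vertices have two children (half_tanh_mean_step). So l tends to 0 even when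
    m psi = 1.

    If m psi > 1, choose s between 1 / m and psi. For a large power C, the
    function 1 - X ^ (-C) is multiplied by at least s along an edge
    (edge_map_percolation), as the survival probability of a percolation with
    retention probability s. That percolation is supercritical, so with positive
    probability the ratio stays away from 1 at all depths (near1_mean_lt1). The ratio of
    the root is close to 1 only if those of all its children are, and since every
    vertex has a child and some have two, this is a contraction that improves
    positive probability to probability 1, uniformly in the depth (near1_uniform).

    Both arguments are carried out on the tree where each vertex keeps at most K
    children. There a ratio at finite depth is a function of finitely many
    independent variables with finitely many values, and expectations are iterated
    finite sums (wsum), the same device that factorizes the sums over edge
    configurations. The bound at criticality is uniform in K and passes to the full
    tree by monotone limits; above criticality one large K is enough, because the
    ratio increases with the tree. *)

(** * Iterated weighted sums over finitely many coordinates *)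

Definition upd (I : eqType) (T : Type) (e : I -> T) (v : I) (k : T) : I -> T :=
  fun u => if u == v then k else e u.

Definition depends_on (I : eqType) (T V : Type) (s : seq I)
    (Phi : (I -> T) -> V) : Prop :=
  forall e e', {in s, e =1 e'} -> Phi e = Phi e'.

Section WeightedSum.
Variables (R : comPzRingType) (I : eqType) (T : finType) (wt : T -> R).
Implicit Types (s t : seq I) (Phi Psi : (I -> T) -> R) (e : I -> T).

(** When wt is a probability vector this is the expectation of Phi once the
    coordinates listed in s are drawn independently with law wt, the other ones
    being read off e. *)
Fixpoint wsum s Phi e : R :=
  if s is v :: s' then \sum_k wt k * wsum s' Phi (upd e v k) else Phi e.

Lemma upd_swap e (u v : I) k l : u != v ->
  upd (upd e u k) v l = upd (upd e v l) u k.
Proof.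
move=> uv; apply/funext => x; rewrite /upd.
by case: (eqVneq x v) => [->|//]; rewrite eq_sym (negPf uv).
Qed.

Lemma eq_wsum s Phi Psi e : (forall e', Phi e' = Psi e') ->
  wsum s Phi e = wsum s Psi e.
Proof. by move=> h; congr (wsum s _ e); apply/funext. Qed.

Lemma wsum_cat s t Phi e :
  wsum (s ++ t) Phi e = wsum s (fun e' => wsum t Phi e') e.
Proof. by elim: s e => //= v s IH e; apply: eq_bigr => k _; rewrite IH. Qed.

Lemma wsumD s Phi Psi e :
  wsum s (fun e' => Phi e' + Psi e') e = wsum s Phi e + wsum s Psi e.
Proof.
elim: s e => //= v s IH e; rewrite -big_split /=.
by apply: eq_bigr => k _; rewrite IH mulrDr.
Qed.

Lemma wsumZ s c Phi e : wsum s (fun e' => c * Phi e') e = c * wsum s Phi e.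
Proof.
elim: s e => //= v s IH e; rewrite mulr_sumr.
by apply: eq_bigr => k _; rewrite IH mulrCA.
Qed.

Lemma wsumB s Phi Psi e :
  wsum s (fun e' => Phi e' - Psi e') e = wsum s Phi e - wsum s Psi e.
Proof.
rewrite -[- wsum s Psi e]mulN1r -wsumZ -wsumD.
by apply: eq_wsum => e'; rewrite mulN1r.
Qed.

Lemma wsum_sum (J : Type) (r : seq J) s (F : J -> (I -> T) -> R) e :
  wsum s (fun e' => \sum_(j <- r) F j e') e = \sum_(j <- r) wsum s (F j) e.
Proof.
elim: r => [|j r IH].
  rewrite big_nil -[RHS](mul0r (wsum s (fun=> 0) e)) -wsumZ.
  by apply: eq_wsum => e'; rewrite big_nil mul0r.
rewrite big_cons -IH -wsumD.
by apply: eq_wsum => e'; rewrite big_cons.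
Qed.

Lemma wsum_insert s1 s2 (v : I) Phi e :
  wsum (s1 ++ v :: s2) Phi e = wsum (v :: s1 ++ s2) Phi e.
Proof.
elim: s1 e => //= u s1 IH e.
under eq_bigr => k _ do rewrite IH /= mulr_sumr.
rewrite exchange_big /=; have [->|uv] := eqVneq u v.
  rewrite exchange_big /=; apply: eq_bigr => k _.
  by rewrite mulr_sumr.
apply: eq_bigr => k _; rewrite mulr_sumr; apply: eq_bigr => l _.
by rewrite mulrCA upd_swap.
Qed.

(** Lets the edges of the graph, whose enumeration is arbitrary, be summed in the
    depth-first order of the tree. *)
Lemma perm_wsum s t Phi e : perm_eq s t -> wsum s Phi e = wsum t Phi e.
Proof.
elim: s t e => [|v s IH] t e st.
  by move: st; rewrite perm_sym => /perm_nilP ->.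
have vt : v \in t by rewrite -(perm_mem st) mem_head.
case/splitPr: vt st => t1 t2 st; rewrite wsum_insert /=.
apply: eq_bigr => k _; rewrite (IH (t1 ++ t2)) //.
rewrite -(perm_cons v); apply: (perm_trans st).
by rewrite perm_catC /= perm_cons perm_catC.
Qed.

Lemma depends_upd s Phi v k : depends_on (v :: s) Phi ->
  depends_on s (fun e => Phi (upd e v k)).
Proof.
move=> dep e e' ee'; apply: dep => u; rewrite /upd.
by case: (eqVneq u v) => // uv; rewrite inE (negPf uv) /=; apply: ee'.
Qed.

Lemma depends_sub (V : Type) s t (Phi : (I -> T) -> V) : {subset s <= t} ->
  depends_on s Phi -> depends_on t Phi.
Proof. by move=> st dep e e' ee'; apply: dep => u /st; apply: ee'. Qed.

Lemma depends_wsum s t Phi : depends_on (s ++ t) Phi -> depends_on t (wsum s Phi).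
Proof.
elim: s t => //= v s IH t dep e e' ee'.
apply: eq_bigr => k _; congr (_ * _).
have /IH : depends_on (s ++ v :: t) Phi.
  by apply: depends_sub dep => u; rewrite !(inE, mem_cat) orbCA.
apply=> u; rewrite inE /upd; case: eqVneq => //= _; exact: ee'.
Qed.

Lemma wsum_indep s Phi e e' : depends_on s Phi -> wsum s Phi e = wsum s Phi e'.
Proof.
move=> dep; apply: (@depends_wsum s [::]) => //; by rewrite cats0.
Qed.

Lemma wsum_factor s t Phi Psi e : depends_on t Phi -> ~~ has (mem s) t ->
  wsum s (fun e' => Phi e' * Psi e') e = Phi e * wsum s Psi e.
Proof.
move=> dep; elim: s e => //= v s IH e st.
rewrite mulr_sumr; apply: eq_bigr => k _.
rewrite IH; last first.
  by apply: contra st => /hasP[u ut us]; apply/hasP; exists u => //=; apply/orP; right.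
rewrite mulrCA; congr (_ * _); apply: dep => u ut; rewrite /upd.
by case: eqVneq => // uv; case/hasP: st; exists u => //=; rewrite uv mem_head.
Qed.

(** Independence, as in Fubini's theorem: the inner sum does not see the outer
    coordinates, so it is a constant factor of the outer sum. *)
Lemma wsumM s t Phi Psi e : depends_on s Phi -> depends_on t Psi ->
  ~~ has (mem t) s ->
  wsum (s ++ t) (fun e' => Phi e' * Psi e') e = wsum s Phi e * wsum t Psi e.
Proof.
move=> dPhi dPsi st; rewrite wsum_cat.
transitivity (wsum s (fun e' => wsum t Psi e * Phi e') e).
  apply: eq_wsum => e'; rewrite (wsum_factor _ _ dPhi) // mulrC.
  by rewrite (wsum_indep e' e dPsi).
by rewrite wsumZ mulrC.
Qed.

Lemma depends_prod (J : eqType) (r : seq J) (S : J -> seq I)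
    (F : J -> (I -> T) -> R) : (forall j, j \in r -> depends_on (S j) (F j)) ->
  depends_on (flatten [seq S j | j <- r]) (fun e => \prod_(j <- r) F j e).
Proof.
move=> dep e e' ee'; apply: eq_big_seq => j jr; apply: dep => // u uS.
by apply: ee'; apply/flattenP; exists (S j) => //; apply: map_f.
Qed.

Lemma wsum_prod (J : eqType) (r : seq J) (S : J -> seq I)
    (F : J -> (I -> T) -> R) e : uniq r ->
  (forall j, j \in r -> depends_on (S j) (F j)) ->
  (forall i j, i \in r -> j \in r -> i != j -> ~~ has (mem (S i)) (S j)) ->
  wsum (flatten [seq S j | j <- r]) (fun e' => \prod_(j <- r) F j e') e =
  \prod_(j <- r) wsum (S j) (F j) e.
Proof.
elim: r => [|j r IH] /=; first by rewrite !big_nil.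
case/andP=> jr ur dep disj; rewrite big_cons -IH //; last 2 first.
- by move=> i ir; apply: dep; rewrite inE ir orbT.
- by move=> i k ir kr; apply: disj; rewrite inE ?ir ?kr orbT.
rewrite -wsumM.
- by apply: eq_wsum => e'; rewrite big_cons.
- by apply: dep; rewrite mem_head.
- by apply: depends_prod => i ir; apply: dep; rewrite inE ir orbT.
- apply/hasP => -[u uj /flattenP[_ /mapP[i ir ->] ui]].
  have ij : i != j by apply: contraNneq jr => <-.
  have := disj i j; rewrite !inE ir orbT eqxx => /(_ isT isT ij)/hasP; apply.
  by exists u.
Qed.

Lemma wsum_cst s c e : \sum_k wt k = 1 -> wsum s (fun=> c) e = c.
Proof.
move=> wt1; elim: s e => //= v s IH e.
by under eq_bigr => k _ do rewrite IH; rewrite -mulr_suml wt1 mul1r.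
Qed.

End WeightedSum.

(** This carries the edges of the graph to words, and makes the subtree of a
    vertex a copy of the whole tree. *)
Lemma wsum_comp (R : comPzRingType) (I I' : eqType) (T : finType) (wt : T -> R)
    (sigma : I -> I') s (Phi : (I -> T) -> R) (e : I' -> T) :
  injective sigma ->
  wsum wt (map sigma s) (fun e' => Phi (e' \o sigma)) e =
  wsum wt s Phi (e \o sigma).
Proof.
move=> inj; elim: s e => //= v s IH e; apply: eq_bigr => k _; rewrite IH.
congr (_ * wsum wt s Phi _); apply/funext => u /=.
by rewrite /upd (inj_eq inj).
Qed.

Lemma ler_wsum (R : numDomainType) (I : eqType) (T : finType) (wt : T -> R)
    (s : seq I) (Phi Psi : (I -> T) -> R) e : (forall k, 0 <= wt k) ->
  (forall e', Phi e' <= Psi e') -> wsum wt s Phi e <= wsum wt s Psi e.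
Proof.
move=> wt0 le; elim: s e => //= v s IH e.
by apply: ler_sum => k _; apply: ler_wpM2l.
Qed.

Lemma wsum_ge0 (R : numDomainType) (I : eqType) (T : finType) (wt : T -> R)
    (s : seq I) (Phi : (I -> T) -> R) e : (forall k, 0 <= wt k) ->
  (forall e', 0 <= Phi e') -> 0 <= wsum wt s Phi e.
Proof.
move=> wt0 Phi0; elim: s e => //= v s IH e.
by apply: sumr_ge0 => k _; apply: mulr_ge0.
Qed.

(** Freezing the entries outside s at c is what allows an induction on s. *)
Lemma wsum_partial (R : comPzRingType) (E T : finType) (wt : T -> R)
    (s : seq E) (Phi : (E -> T) -> R) (c : E -> T) : uniq s ->
  wsum wt s Phi c =
  \sum_(w : {ffun E -> T} | [forall x, (x \notin s) ==> (w x == c x)])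
     (\prod_(x <- s) wt (w x)) * Phi w.
Proof.
elim: s c => [|v s IH] c /=.
  move=> _; rewrite (big_pred1 [ffun x => c x]) => [|w].
    by rewrite big_nil mul1r; congr Phi; apply/funext => x; rewrite ffunE.
  apply/forallP/eqP => [h|-> x]; last by rewrite ffunE.
  by apply/ffunP => x; rewrite ffunE; apply/eqP; have := h x.
case/andP=> vs us; rewrite [RHS](partition_big (fun w : {ffun E -> T} => w v) predT) //=.
apply: eq_bigr => k _; rewrite IH // mulr_sumr; apply: eq_big => w.
  apply/forallP/andP => [h|[/forallP h /eqP wv] x].
    split; last by have := h v; rewrite vs /upd eqxx.
    apply/forallP => x; have := h x; rewrite inE negb_or /upd.
    by case: (eqVneq x v).
  have := h x; rewrite inE negb_or /upd; case: (eqVneq x v) => //= -> _.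
  by rewrite wv eqxx implybT.
move=> /forallP/(_ v); rewrite vs /upd eqxx /= => /eqP <-.
by rewrite big_cons mulrA.
Qed.

Lemma sum_ffun_wsum (R : comPzRingType) (E T : finType) (wt : T -> R)
    (Phi : (E -> T) -> R) (c : E -> T) :
  \sum_(w : {ffun E -> T}) (\prod_x wt (w x)) * Phi w = wsum wt (enum E) Phi c.
Proof.
rewrite wsum_partial ?enum_uniq //; apply: eq_big => [w|w _].
  by apply/esym/forallP => x; rewrite mem_enum.
by rewrite big_enum.
Qed.

(** * Words of the tree *)

(** The descendants are listed depth-first, so that the progenies of the children
    of v are consecutive blocks and sums over them factorize. With N constant
    equal to K this lists all the words that a tree with at most K children per
    vertex can use, whatever its offspring numbers. *)
Fixpoint below (N : seq nat -> nat) (k : nat) (v : seq nat) : seq (seq nat) :=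
  if k is k'.+1 then
    flatten [seq (i :: v) :: below N k' (i :: v) | i <- iota 0 (N v)]
  else [::].

Fixpoint in_tree (N : seq nat -> nat) (u : seq nat) : bool :=
  if u is i :: v then (i < N v)%N && in_tree N v else true.

Section Words.
Variable N : seq nat -> nat.

Lemma mem_generation k u : (u \in generation N k) = (size u == k) && in_tree N u.
Proof.
elim: k u => [|k IH] u; first by rewrite inE; case: u.
apply/allpairsPdep/andP => [[v [i [vk iv ->]]]|[]].
  by move: vk iv; rewrite IH mem_iota add0n => /andP[/eqP <- /= ->] ->.
case: u => //= i v; rewrite eqSS => sv /andP[iv tv].
by exists v, i; rewrite IH sv tv mem_iota add0n.
Qed.

Lemma mem_tree_vertices n u :
  (u \in tree_vertices N n) = (size u <= n)%N && in_tree N u.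
Proof.
apply/flattenP/andP => [[s /mapP[k]]|[un tu]].
  rewrite mem_iota add0n => /andP[_ kn] ->.
  by rewrite mem_generation => /andP[/eqP ->].
exists (generation N (size u)); last by rewrite mem_generation eqxx.
by apply: map_f; rewrite mem_iota add0n ltnS.
Qed.

Lemma suffix_child (i j : nat) (v u : seq nat) :
  suffix (i :: v) u -> suffix (j :: v) u -> i = j.
Proof.
move=> /suffixP[s1 ->] /suffixP[s2 e].
have ss : size s1 = size s2.
  by have := congr1 size e; rewrite !size_cat => /eqP; rewrite eqn_add2r => /eqP.
by move/eqP: e; rewrite eqseq_cat // => /andP[_ /eqP[]].
Qed.

Lemma below_suffix k v u : u \in below N k v -> suffix v u && (size v < size u)%N.
Proof.
elim: k v => //= k IH v /flattenP[_ /mapP[i _ ->]].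
rewrite inE => /orP[/eqP ->|/IH/andP[su lu]].
  by rewrite suffix_cons /= leqnn.
rewrite (suffix_trans _ su) ?suffix_cons //=.
by apply: ltn_trans lu => /=.
Qed.

Lemma notin_below k v : v \notin below N k v.
Proof. by apply/negP => /below_suffix; rewrite ltnn andbF. Qed.

(** A common word would carry two different letters above its suffix v. *)
Lemma child_disjoint (N' : seq nat -> nat) k l v i j : i != j ->
  ~~ has (mem ((i :: v) :: below N k (i :: v))) ((j :: v) :: below N' l (j :: v)).
Proof.
have suf N0 m a u : u \in (a :: v) :: below N0 m (a :: v) -> suffix (a :: v) u.
  rewrite inE => /orP[/eqP ->|]; first exact: suffix_refl.
  elim: m (a :: v) => //= m IH x /flattenP[_ /mapP[b _ ->]].
  rewrite inE => /orP[/eqP ->|/IH]; first by rewrite suffix_cons.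
  by apply: suffix_trans; rewrite suffix_cons.
move=> ij; apply/hasP => -[u uj ui].
by case/eqP: ij; apply: (@suffix_child _ _ v u); [exact: suf ui | exact: suf uj].
Qed.

Lemma uniq_flatten_map (J I : eqType) (r : seq J) (S : J -> seq I) : uniq r ->
  (forall j, j \in r -> uniq (S j)) ->
  (forall i j, i \in r -> j \in r -> i != j -> ~~ has (mem (S i)) (S j)) ->
  uniq (flatten [seq S j | j <- r]).
Proof.
elim: r => //= j r IH /andP[jr ur] uS disj.
rewrite cat_uniq uS ?mem_head //= IH ?andbT //; last 2 first.
- by move=> i ir; apply: uS; rewrite inE ir orbT.
- by move=> i k ir kr; apply: disj; rewrite inE ?ir ?kr orbT.
apply/hasP => -[u /flattenP[_ /mapP[i ir ->] ui] uj].
have ji : j != i by apply: contraNneq jr => ->.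
have := disj j i; rewrite !inE ir orbT eqxx => /(_ isT isT ji)/hasP; apply.
by exists u.
Qed.

Lemma uniq_below k v : uniq (below N k v).
Proof.
elim: k v => //= k IH v; apply: uniq_flatten_map; first exact: iota_uniq.
- by move=> i _; rewrite /= notin_below IH.
- by move=> i j _ _; apply: child_disjoint.
Qed.

Lemma mem_below_root n u :
  (u \in below N n [::]) = [&& u != [::], (size u <= n)%N & in_tree N u].
Proof.
have memb k v : in_tree N v -> forall x, (x \in below N k v) =
    [&& suffix v x, (size v < size x)%N, (size x <= k + size v)%N & in_tree N x].
  elim: k v => [|k IH] v tv x.
    rewrite add0n; apply/esym/negP => /and4P[_ lx].
    by rewrite leqNgt lx.
  apply/idP/idP => [/flattenP[_ /mapP[i iN ->]]|].
    move: iN; rewrite mem_iota add0n => /= iN.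
    rewrite inE => /orP[/eqP ->|].
      by rewrite suffix_cons /= ltnSn iN tv addSn ltnS leq_addl.
    rewrite IH /= ?iN // => /and4P[sx lx xk ->].
    by rewrite (suffix_trans _ sx) ?suffix_cons //= addSnnS xk (ltnW lx).
  case/and4P=> /suffixP[z ->]; rewrite size_cat.
  case/lastP: z => [|z i]; first by rewrite add0n ltnn.
  rewrite cat_rcons size_rcons => _; rewrite leq_add2r ltnS => zk tx.
  have iN : (i < N v)%N.
    by elim: z tx {zk} => [|a z IHz] /= /andP[].
  apply/flattenP; exists ((i :: v) :: below N k (i :: v)).
    by apply/mapP; exists i => //; rewrite mem_iota add0n.
  rewrite inE; case: eqP => //= /eqP ne; rewrite IH /= ?iN // tx suffix_suffix /=.
  rewrite size_cat /= leq_add2r zk.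
    case: z ne {zk tx} => [|a z _]; first by rewrite /= eqxx.
    by rewrite /= addSn ltnS leq_addl.
rewrite memb // suffix0s /= addn0; by case: u.
Qed.

End Words.

(** * Clusters of the wired tree *)

(** W u is the state of the edge from u to its parent. When k is the distance
    from v to the leaves, this is the connection of v to the wired boundary inside
    its own progeny. *)
Fixpoint reaches (N : seq nat -> nat) (W : seq nat -> bool) (k : nat)
    (v : seq nat) : bool :=
  if k is k'.+1 then
    has (fun i => W (i :: v) && reaches N W k' (i :: v)) (iota 0 (N v))
  else true.

(** The representative of the cluster of u before the leaves are merged. *)
Fixpoint top (W : seq nat -> bool) (u : seq nat) : seq nat :=
  if u is _ :: v then if W u then top W v else u else [::].

(** r maps the roots of the components bijectively onto its fixed points. *)
Lemma n_comp_repr (T : finType) (e : rel T) (r : T -> T) : connect_sym e ->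
  (forall x, connect e x (r x)) -> (forall x y, e x y -> r x = r y) ->
  n_comp e predT = #|[set x | r x == x]|.
Proof.
move=> syme conr re.
have rcon x y : connect e x y -> r x = r y.
  by case/connectP=> s + ->; elim: s x => //= z s IH x /andP[/re -> /IH].
rewrite /n_comp_mem.
transitivity #|[set x | roots e x]|; first by apply: eq_card => x; rewrite !inE andbT.
rewrite -(@card_in_imset _ _ r [set x | roots e x]).
  apply: eq_card => x; rewrite inE; apply/imsetP/eqP => [[y _ ->]|rx].
    by apply/esym/rcon/conr.
  exists (fingraph.root e x); first by rewrite inE roots_root.
  by rewrite -(rcon _ _ (connect_root e x)).
move=> x y; rewrite !inE => /eqP rx /eqP ry rxy.
rewrite -rx -ry; apply/eqP; rewrite root_connect //.
by apply: connect_trans (conr x) _; rewrite rxy syme.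
Qed.

Section WiredClusters.
Variables (N : seq nat -> nat) (n : nat) (W : seq nat -> bool).
Local Notation G := (wired_tree N n).
Local Notation leaves := (tree_leaves N n).

Definition edge_word (e : edge G) : seq nat := ssval (val e).

Let w : {ffun edge G -> bool} := [ffun e => W (edge_word e)].

(** Words of the last generation go to the merged vertex None; so do words
    outside the tree, where this is never used. *)
Definition word_vert (u : seq nat) : vert G :=
  if insub u is Some x then proj_vert leaves (x : tree_vert N n) else None.

Definition height (u : seq nat) : nat := (n - size u)%N.

(** A cluster touching the leaves is represented by the merged vertex, any other
    one by its top. *)
Definition word_rep (u : seq nat) : vert G :=
  if reaches N W (height (top W u)) (top W u) then None else word_vert (top W u).

Definition vert_rep (x : vert G) : vert G :=
  if x is Some y then word_rep (ssval (val y)) else None.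

Lemma word_vertE (x : tree_vert N n) : word_vert (ssval x) = proj_vert leaves x.
Proof. by rewrite /word_vert valK. Qed.

Lemma word_vert_root :
  word_vert [::] = proj_vert leaves (tree_root N n).
Proof. by rewrite -word_vertE. Qed.

Lemma word_vert_some (y : {y : vert (tree_graph N n) | y \notin leaves}) :
  word_vert (ssval (val y)) = Some y.
Proof. by rewrite word_vertE /proj_vert valK. Qed.

Lemma word_vert_leaf u : (n <= size u)%N -> word_vert u = None.
Proof.
move=> nu; rewrite /word_vert; case: insubP => // x _ xu.
rewrite /proj_vert insubF //; apply/negbTE; rewrite negbK inE -/(val x) xu.
by rewrite eqn_leq nu -xu; have := ssvalP x; rewrite mem_tree_vertices => /andP[->].
Qed.

Lemma word_vert_inner u : (size u < n)%N -> in_tree N u ->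
  exists2 y, word_vert u = Some y & ssval (val y) = u.
Proof.
move=> un tu.
have ut : u \in tree_vertices N n by rewrite mem_tree_vertices ltnW.
have nl : (SeqSub ut : vert (tree_graph N n)) \notin leaves.
  by rewrite inE /= neq_ltn un.
exists (Sub (SeqSub ut : vert (tree_graph N n)) nl); last by rewrite SubK.
by rewrite -word_vert_some SubK.
Qed.

Lemma height_cons i v : (size v < n)%N -> height v = (height (i :: v)).+1.
Proof. by move=> vn; rewrite /height /= subnSK. Qed.

Lemma open_adj_step i v : (size v < n)%N -> in_tree N (i :: v) -> W (i :: v) ->
  open_adj w (word_vert (i :: v)) (word_vert v).
Proof.
move=> vn tv Wv.
have ut : i :: v \in tree_vertices N n by rewrite mem_tree_vertices tv andbT.
have ne : ssval (SeqSub ut : tree_vert N n) != [::] by [].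
apply/existsP; exists (Sub (SeqSub ut : tree_vert N n) ne).
rewrite ffunE /edge_word SubK Wv /=; apply/orP; right.
by rewrite -!word_vertE SubK.
Qed.

Lemma open_adjP x y : open_adj w x y -> exists i v,
  [/\ (size v < n)%N, in_tree N (i :: v), W (i :: v) &
      (x = word_vert v /\ y = word_vert (i :: v)) \/
      (x = word_vert (i :: v) /\ y = word_vert v)].
Proof.
case/existsP=> e; rewrite ffunE /= -!word_vertE /=.
rewrite /edge_word; have := ssvalP (val e); have := valP e.
case: (ssval (val e)) => //= i v _; rewrite mem_tree_vertices => /andP[sv tv].
case/andP=> Wv /orP xy; exists i, v; split => //.
by case: xy => /eqP[<- <-]; [left|right].
Qed.

Lemma open_adj_sym : symmetric (open_adj w).
Proof.
by move=> x y; rewrite /open_adj; apply: eq_existsb => e; rewrite orbC.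
Qed.

Lemma connect_open_adj_sym : connect_sym (open_adj w).
Proof. exact: sym_connect_sym open_adj_sym. Qed.

Lemma top_in_tree u : in_tree N u -> in_tree N (top W u).
Proof.
by elim: u => //= i v IH /andP[iv tv]; case: ifP => _ /=; rewrite ?iv //; apply: IH.
Qed.

Lemma size_top u : (size (top W u) <= size u)%N.
Proof. by elim: u => //= i v IH; case: ifP => // _; apply: leqW. Qed.

Lemma reaches_top u : in_tree N u -> (size u <= n)%N ->
  reaches N W (height u) u -> reaches N W (height (top W u)) (top W u).
Proof.
elim: u => //= i v IH /andP[iv tv] vn Du; case: ifP => // Wv.
apply: IH => //; first exact: ltnW.
rewrite (height_cons i) //=; apply/hasP; exists i; first by rewrite mem_iota.
by rewrite Wv.
Qed.

Lemma vert_repE u : in_tree N u -> (size u <= n)%N ->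
  vert_rep (word_vert u) = word_rep u.
Proof.
move=> tu; rewrite leq_eqVlt => /orP[/eqP un|un]; last first.
  by have [y -> /= ->] := word_vert_inner un tu.
rewrite word_vert_leaf ?un // /= /word_rep reaches_top ?un //.
by rewrite /height un subnn.
Qed.

Lemma connect_top u : in_tree N u -> (size u <= n)%N ->
  connect (open_adj w) (word_vert u) (word_vert (top W u)).
Proof.
elim: u => //= i v IH /andP[iv tv] vn; case: ifP => // Wv.
apply: connect_trans (IH tv (ltnW vn)); apply: connect1.
by apply: open_adj_step => //=; rewrite iv.
Qed.

Lemma connect_reaches u : in_tree N u -> (size u <= n)%N ->
  reaches N W (height u) u -> connect (open_adj w) (word_vert u) None.
Proof.
move: {2}(height u) (erefl (height u)) => k; elim: k u => [|k IH] u hu tu un.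
  by move=> _; rewrite word_vert_leaf // -subn_eq0 -/(height u) hu.
have lun : (size u < n)%N by rewrite -subn_gt0 -/(height u) hu.
rewrite hu => /hasP[i]; rewrite mem_iota add0n => /= iu /andP[Wi Di].
have hi : height (i :: u) = k by apply/eqP; rewrite -eqSS -height_cons ?hu.
apply: connect_trans (IH (i :: u) hi _ _ _) => //=; rewrite ?iu ?hi //.
rewrite connect_open_adj_sym; apply: connect1; apply: open_adj_step => //=.
by rewrite iu.
Qed.

Lemma connect_vert_rep x : connect (open_adj w) x (vert_rep x).
Proof.
case: x => [y|] //=; rewrite -word_vert_some /word_rep.
have := ssvalP (val y); rewrite mem_tree_vertices => /andP[yn ty].
have cy := connect_top ty yn; case: ifP => // Dt.
apply: connect_trans cy (connect_reaches _ _ Dt); first exact: top_in_tree.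
exact: leq_trans (size_top _) yn.
Qed.

(** Crossing an open edge does not change the top of a cluster; at an edge leading
    to a leaf, that top reaches the leaves and both ends are represented by the
    merged vertex. *)
Lemma vert_rep_adj x y : open_adj w x y -> vert_rep x = vert_rep y.
Proof.
case/open_adjP=> i [v [vn tv Wv xy]].
have tv' : in_tree N v by case/andP: tv.
have e : vert_rep (word_vert (i :: v)) = vert_rep (word_vert v).
  by rewrite !vert_repE ?(ltnW vn) // /word_rep /= Wv.
by case: xy => -[-> ->].
Qed.

(** An open path to the leaves may go through the merged vertex and climb again,
    but the representative is constant along it, and the root is its own top. *)
Lemma connect_root_leaves :
  connect (open_adj w) (proj_vert leaves (tree_root N n)) None =
  reaches N W n [::].
Proof.
rewrite -word_vert_root; have h0 : height [::] = n by rewrite /height subn0.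
apply/idP/idP => [c|D]; last by apply: connect_reaches; rewrite ?h0.
have : vert_rep (word_vert [::]) = vert_rep None.
  case/connectP: c => s + ->; elim: s (word_vert [::]) => //= z s IH x.
  by case/andP=> /vert_rep_adj -> /IH.
rewrite vert_repE // /word_rep /= h0; case: ifP => // nD.
have n0 : (0 < n)%N by case: (n) nD.
by have [y ->] := @word_vert_inner [::] n0 isT.
Qed.

(** A cluster that does not contain the merged leaves is a subtree hanging from
    its top vertex, which is the root or has a closed edge above it, and from
    which no leaf is reached. *)
Definition cluster_top (u : seq nat) : bool :=
  ((u == [::]) || ~~ W u) && ~~ reaches N W (height u) u.

(** The successor counts the cluster of the merged vertex, which is present even
    when the last generation is empty. *)
Lemma n_clusters_tops :
  n_clusters w = (count cluster_top ([::] :: below N n [::])).+1.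
Proof.
rewrite /n_clusters (n_comp_repr connect_open_adj_sym connect_vert_rep vert_rep_adj).
rewrite (cardsD1 None) inE eqxx add1n; congr S.
set A := _ :\ _; set tops := [::] :: _.
pose f (x : vert G) : seq nat := if x is Some y then ssval (val y) else [::].
have fin x : x \in A -> f x \in tops /\ cluster_top (f x).
  rewrite !inE; case: x => [y|] //= /eqP ry.
  have := ssvalP (val y); rewrite mem_tree_vertices => /andP[yn ty].
  rewrite mem_below_root yn ty !andbT orbN; split => //.
  move: ry; rewrite /word_rep /cluster_top; case: ifP => // nD.
  set u := ssval (val y) in nD yn ty *; rewrite -word_vert_some -/u => eu.
  have tu : top W u = u.
    have tt := top_in_tree ty.
    have tn : (size (top W u) < n)%N.
      by rewrite -subn_gt0; move: nD; rewrite -/(height _); case: (height _).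
    have [z ez <-] := word_vert_inner tn tt.
    by move: eu; rewrite ez word_vert_some => -[->].
  rewrite tu in nD; rewrite nD andbT; move: tu; case: (u) => //= i v.
  case: ifP => // _ e; have := size_top v; rewrite e /=.
  by rewrite ltnn.
have finj : {in A &, injective f}.
  move=> x y; rewrite !inE; case: x => [x|] //; case: y => [y|] // _ _ /= e.
  by congr Some; apply/val_inj/val_inj.
rewrite -size_filter cardE -(size_map f); apply/perm_size/uniq_perm.
- by rewrite map_inj_in_uniq ?enum_uniq // => x y; rewrite !mem_enum; apply: finj.
- by apply: filter_uniq; rewrite /= notin_below uniq_below.
move=> u; rewrite mem_filter; apply/mapP/andP => [[x]|[cu tu]].
  by rewrite mem_enum => /fin[tx cx] ->.
have [nu tu'] : (size u <= n)%N /\ in_tree N u.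
  by move: tu; rewrite inE mem_below_root => /orP[/eqP ->|/and3P[]].
have un : (size u < n)%N.
  rewrite -subn_gt0; case/andP: cu => _; rewrite /height.
  by case: (n - size u)%N.
have [y ey yu] := word_vert_inner un tu'.
exists (Some y) => //; rewrite mem_enum !inE /= yu.
have topu : top W u = u.
  by case/andP: cu => /orP[/eqP -> //|]; case: (u) => //= i v /negPf ->.
by rewrite /word_rep topu; case/andP: cu => _ /negPf ->; rewrite ey.
Qed.

End WiredClusters.

(** * Random cluster weights on a wired tree *)

Definition edge_weight (R : pzRingType) (p : R) (b : bool) : R :=
  if b then p else 1 - p.

(** Here k is the distance from u to the leaves, and u is not the root. A leaf
    reaches itself, so that it never contributes a factor q. *)
Definition top_weight (R : pzRingType) (q : R) (N : seq nat -> nat) (k : nat)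
    (u : seq nat) (W : seq nat -> bool) : R :=
  if ~~ W u && ~~ reaches N W k u then q else 1.

(** Defined through the children, so as to factorize in the same way as the sums
    over configurations. *)
Fixpoint below_weight (R : pzRingType) (q : R) (N : seq nat -> nat) (k : nat)
    (v : seq nat) (W : seq nat -> bool) : R :=
  if k is k'.+1 then \prod_(i <- iota 0 (N v))
    (top_weight q N k' (i :: v) W * below_weight q N k' (i :: v) W)
  else 1.

Lemma expr_count (R : comPzRingType) (T : Type) (q : R) (P : pred T) (s : seq T) :
  q ^+ count P s = \prod_(u <- s) (if P u then q else 1).
Proof.
elim: s => [|u s IH] /=; first by rewrite big_nil.
by rewrite big_cons exprD IH; case: (P u).
Qed.

Section Weights.
Variables (R : comPzRingType) (q : R) (N : seq nat -> nat).

Lemma below_weightE k v W :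
  \prod_(u <- below N k v) top_weight q N (k + size v - size u) u W =
  below_weight q N k v W.
Proof.
elim: k v => [|k IH] v /=; first by rewrite big_nil.
rewrite big_flatten big_map; apply: eq_bigr => i _.
rewrite big_cons -IH; congr (_ * _).
  by rewrite addSn /= subSS addnK.
by apply: eq_bigr => u _; rewrite addSnnS.
Qed.

Lemma depends_reaches k v :
  depends_on (below N k v) (fun W => reaches N W k v).
Proof.
elim: k v => [|k IH] v W W' WW' //=; apply: eq_in_has => i iv.
have sub u : u \in (i :: v) :: below N k (i :: v) -> W u = W' u.
  move=> uS; apply: WW'; apply/flattenP; exists ((i :: v) :: below N k (i :: v)) => //.
  by apply: map_f.
rewrite sub ?mem_head // (IH (i :: v) W W') // => u uS.
by apply: sub; rewrite inE uS orbT.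
Qed.

Lemma depends_below_weight k v : depends_on (below N k v) (below_weight q N k v).
Proof.
elim: k v => [|k IH] v W W' WW' //=; apply: eq_big_seq => i iv.
have sub u : u \in (i :: v) :: below N k (i :: v) -> W u = W' u.
  move=> uS; apply: WW'; apply/flattenP; exists ((i :: v) :: below N k (i :: v)) => //.
  by apply: map_f.
have sub' : {in below N k (i :: v), W =1 W'}.
  by move=> u uS; apply: sub; rewrite inE uS orbT.
rewrite (IH _ _ _ sub') /top_weight sub ?mem_head //.
by rewrite (depends_reaches sub').
Qed.

End Weights.

Section TreePartition.
Variables (R : comPzRingType) (p q : R) (N : seq nat -> nat).

(** The partition functions of the subtree of v cut k generations below v,
    restricted to the configurations where v reaches, or misses, the last
    generation; the cluster of v itself is not counted. *)
Definition Zhit (k : nat) (v : seq nat) : R :=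
  wsum (edge_weight p) (below N k v)
    (fun W => (reaches N W k v)%:R * below_weight q N k v W) (fun=> false).
Definition Zmiss (k : nat) (v : seq nat) : R :=
  wsum (edge_weight p) (below N k v)
    (fun W => (~~ reaches N W k v)%:R * below_weight q N k v W) (fun=> false).

Lemma depends_hit (f : bool -> R) k v : depends_on (below N k v)
  (fun W => f (reaches N W k v) * below_weight q N k v W).
Proof.
by move=> W W' WW'; rewrite (depends_reaches WW') (depends_below_weight _ WW').
Qed.

Lemma wsum_edge k u (Phi1 Phi0 Phi : (seq nat -> bool) -> R) e :
  (forall W, Phi W = if W u then Phi1 W else Phi0 W) ->
  wsum (edge_weight p) (u :: below N k u) Phi e =
  p * wsum (edge_weight p) (below N k u) Phi1 (upd e u true) +
  (1 - p) * wsum (edge_weight p) (below N k u) Phi0 (upd e u false).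
Proof.
move=> PhiE; rewrite /= big_bool /=.
have split b : wsum (edge_weight p) (below N k u) Phi (upd e u b) =
    if b then wsum (edge_weight p) (below N k u) Phi1 (upd e u b)
    else wsum (edge_weight p) (below N k u) Phi0 (upd e u b).
  have -> : Phi = fun W => (W u)%:R * Phi1 W + (~~ W u)%:R * Phi0 W.
    apply/funext => W; rewrite PhiE.
    by case: (W u); rewrite !(mul1r, mul0r, addr0, add0r).
  have du (f : bool -> R) : depends_on [:: u] (fun W : seq nat -> bool => f (W u)).
    by move=> W W' WW'; rewrite WW' ?mem_head.
  have un : ~~ has (mem (below N k u)) [:: u] by rewrite /= orbF notin_below.
  rewrite wsumD (wsum_factor _ _ _ (du (fun b => b%:R))) //.
  rewrite (wsum_factor _ _ _ (du (fun b => (~~ b)%:R))) // /upd eqxx.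
  by case: b; rewrite !(mul1r, mul0r, addr0, add0r).
by rewrite !split.
Qed.

Lemma ZhitD k v : Zhit k v + Zmiss k v =
  wsum (edge_weight p) (below N k v) (below_weight q N k v) (fun=> false).
Proof.
rewrite /Zhit /Zmiss -wsumD; apply: eq_wsum => W.
by rewrite -mulrDl; case: reaches; rewrite ?addr0 ?add0r mul1r.
Qed.

(** The edge above u is summed out: when it is open the cluster of u is counted
    higher up, when it is closed and u misses the leaves it is counted at u. *)
Lemma wsum_child (f : bool -> R) k u :
  wsum (edge_weight p) (u :: below N k u)
    (fun W => f (W u && reaches N W k u) *
       (top_weight q N k u W * below_weight q N k u W)) (fun=> false) =
  p * (f true * Zhit k u + f false * Zmiss k u) +
  (1 - p) * f false * (Zhit k u + q * Zmiss k u).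
Proof.
have shift (g : bool -> R) b :
    wsum (edge_weight p) (below N k u)
      (fun W => g (reaches N W k u) * below_weight q N k u W)
      (upd (fun=> false) u b) = g true * Zhit k u + g false * Zmiss k u.
  rewrite (wsum_indep _ (upd _ _ _) (fun=> false) (depends_hit g (k := k) (v := u))).
  rewrite /Zhit /Zmiss -!wsumZ -wsumD; apply: eq_wsum => W.
  by case: reaches; rewrite !(mul1r, mul0r, mulr0, addr0, add0r).
rewrite (wsum_edge _
  (Phi1 := fun W => f (reaches N W k u) * below_weight q N k u W)
  (Phi0 := fun W => (f false * if reaches N W k u then 1 else q) *
                    below_weight q N k u W)) => [|W]; last first.
  rewrite /top_weight; case: (W u) => /=; first by rewrite mul1r.
  by case: reaches; rewrite /= mulrA.
rewrite shift (shift (fun b => f false * if b then 1 else q)); ring.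
Qed.

(** The choice of f selects an event: with f constant every configuration is kept,
    with f the negation only those where v misses the leaves. *)
Lemma Zchildren (f : bool -> R) k v :
  wsum (edge_weight p) (below N k.+1 v)
    (fun W => \prod_(i <- iota 0 (N v)) (f (W (i :: v) && reaches N W k (i :: v)) *
       (top_weight q N k (i :: v) W * below_weight q N k (i :: v) W)))
    (fun=> false) =
  \prod_(i <- iota 0 (N v))
    (p * (f true * Zhit k (i :: v) + f false * Zmiss k (i :: v)) +
     (1 - p) * f false * (Zhit k (i :: v) + q * Zmiss k (i :: v))).
Proof.
rewrite wsum_prod ?iota_uniq //.
- by apply: eq_bigr => i _; exact: wsum_child.
- move=> i _ W W' WW'; have sub : {in below N k (i :: v), W =1 W'}.
    by move=> u uS; apply: WW'; rewrite inE uS orbT.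
  rewrite /top_weight (depends_reaches sub) (depends_below_weight _ sub).
  by rewrite WW' ?mem_head.
- by move=> i j _ _; apply: child_disjoint.
Qed.

Lemma ZhitD_S k v : Zhit k.+1 v + Zmiss k.+1 v =
  \prod_(i <- iota 0 (N v))
    (p * (Zhit k (i :: v) + Zmiss k (i :: v)) +
     (1 - p) * (Zhit k (i :: v) + q * Zmiss k (i :: v))).
Proof.
rewrite ZhitD; transitivity (\prod_(i <- iota 0 (N v))
    (p * (1 * Zhit k (i :: v) + 1 * Zmiss k (i :: v)) +
     (1 - p) * 1 * (Zhit k (i :: v) + q * Zmiss k (i :: v)))).
  rewrite -(Zchildren (fun=> 1)); apply: eq_wsum => W /=.
  by apply: eq_bigr => i _; rewrite mul1r.
by apply: eq_bigr => i _; rewrite !mul1r mulr1.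
Qed.

Lemma Zmiss_S k v : Zmiss k.+1 v =
  \prod_(i <- iota 0 (N v))
    (p * Zmiss k (i :: v) +
     (1 - p) * (Zhit k (i :: v) + q * Zmiss k (i :: v))).
Proof.
transitivity (\prod_(i <- iota 0 (N v))
    (p * ((~~ true)%:R * Zhit k (i :: v) + (~~ false)%:R * Zmiss k (i :: v)) +
     (1 - p) * (~~ false)%:R * (Zhit k (i :: v) + q * Zmiss k (i :: v)))).
  rewrite -(Zchildren (fun b => (~~ b)%:R)); apply: eq_wsum => W /=.
  elim: (iota 0 (N v)) => [|i s IH]; first by rewrite !big_nil mulr1.
  rewrite !big_cons -IH /= negb_or -mulnb natrM; ring.
by apply: eq_bigr => i _; rewrite /= mul0r add0r mul1r mulr1.
Qed.

End TreePartition.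

Section ConnectionFormula.
Variables (R : realFieldType) (p q : R) (N : seq nat -> nat) (n : nat).
Local Notation G := (wired_tree N n).

Lemma edge_word_inj : injective (@edge_word N n).
Proof. by move=> e e' h; apply/val_inj/val_inj. Qed.

Lemma perm_edge_words :
  perm_eq [seq edge_word e | e <- enum (edge G)] (below N n [::]).
Proof.
apply: uniq_perm; first by rewrite (map_inj_uniq edge_word_inj) enum_uniq.
  exact: uniq_below.
move=> u; rewrite mem_below_root; apply/mapP/and3P => [[e _ ->]|[u0 un tu]].
  rewrite /edge_word; have := ssvalP (val e); rewrite mem_tree_vertices.
  by case/andP=> -> ->; split => //; exact: (valP e).
have ut : u \in tree_vertices N n by rewrite mem_tree_vertices un.
exists (Sub (SeqSub ut : tree_vert N n) u0); first by rewrite mem_enum.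
by rewrite /edge_word SubK.
Qed.

Lemma rc_weight_prod (w : {ffun edge G -> bool}) :
  rc_weight p q w = (\prod_e edge_weight p (w e)) * q ^+ n_clusters w.
Proof.
rewrite /rc_weight; congr (_ * _).
rewrite [RHS](bigID (fun e => w e)) /=; congr (_ * _).
  rewrite -prodr_const; apply: eq_big => [e|e]; first by rewrite inE.
  by rewrite inE => ->.
rewrite -prodr_const; apply: eq_big => [e|e]; first by rewrite inE.
by rewrite inE => /negPf ->.
Qed.

Lemma cluster_weight (W : seq nat -> bool) :
  q ^+ n_clusters ([ffun e => W (edge_word e)] : {ffun edge G -> bool}) =
  q * ((if reaches N W n [::] then 1 else q) * below_weight q N n [::] W).
Proof.
rewrite n_clusters_tops exprS expr_count big_cons.
rewrite /cluster_top /= /height subn0; congr (q * (_ * _)).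
  by case: reaches.
rewrite -below_weightE; apply: eq_big_seq => u; rewrite mem_below_root.
by case/and3P=> /negPf u0 _ _; rewrite /top_weight addn0 u0.
Qed.

(** The edges are listed by their lower endpoints, in the order of the tree, so that
    the sum factorizes; the leading q is the cluster of the merged vertex. *)
Lemma sum_rc_weight (f : bool -> R) :
  \sum_(w : {ffun edge G -> bool})
    f (connect (open_adj w) (proj_vert (tree_leaves N n) (tree_root N n)) None) *
    rc_weight p q w =
  q * (f true * Zhit p q N n [::] + f false * (q * Zmiss p q N n [::])).
Proof.
pose F (c : edge G -> bool) : R :=
  f (connect (open_adj (finfun c)) (proj_vert (tree_leaves N n) (tree_root N n)) None)
  * q ^+ n_clusters (finfun c : {ffun edge G -> bool}).
transitivity (\sum_(w : {ffun edge G -> bool}) (\prod_e edge_weight p (w e)) * F w).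
  apply: eq_bigr => w _; rewrite /F rc_weight_prod mulrCA.
  by have -> : finfun w = w by apply/ffunP => e; rewrite ffunE.
rewrite (sum_ffun_wsum _ _ ((fun=> false) \o @edge_word N n)).
rewrite -(wsum_comp _ _ _ _ edge_word_inj) (perm_wsum _ _ _ perm_edge_words).
transitivity (wsum (edge_weight p) (below N n [::]) (fun W =>
    (q * f true) * ((reaches N W n [::])%:R * below_weight q N n [::] W) +
    (q * f false * q) * ((~~ reaches N W n [::])%:R * below_weight q N n [::] W))
  (fun=> false)).
  apply: eq_wsum => W; rewrite /F cluster_weight connect_root_leaves.
  by case: reaches => /=; ring.
rewrite wsumD !wsumZ /Zhit /Zmiss; ring.
Qed.

Lemma rc_connectE :
  @rc_connect R G p q (proj_vert (tree_leaves N n) (tree_root N n)) None =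
  (q * Zhit p q N n [::]) / (q * (Zhit p q N n [::] + q * Zmiss p q N n [::])).
Proof.
rewrite /rc_connect /rc_prob -mulr_suml; congr (_ / _).
  have /= := sum_rc_weight (fun b => b%:R).
  rewrite mul0r addr0 mul1r => <-; rewrite big_mkcond /=.
  by apply: eq_bigr => w _; case: connect; rewrite ?mul1r ?mul0r.
have /= := sum_rc_weight (fun=> 1); rewrite !mul1r => <-.
by apply: eq_bigr => w _; rewrite mul1r.
Qed.

End ConnectionFormula.

(** * The tree recursion *)

(** With B the exponential of beta, this maps the likelihood ratio of
    connection and disconnection of a vertex (normalized so that 1 means never
    connected) to the one seen through the edge above that vertex. *)
Definition edge_map (R : fieldType) (B q X : R) : R :=
  (B * X + q - 1) / (X + B + q - 2%:R).

(** The ratio of v seen through the edge above v. The ratio at a leaf itself would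
    be infinite; seen through an edge it is B, the limit of edge_map at infinity. *)
Fixpoint edge_ratio (R : fieldType) (B q : R) (N : seq nat -> nat) (n : nat)
    (v : seq nat) : R :=
  if n is k.+1 then
    edge_map B q (\prod_(i <- iota 0 (N v)) edge_ratio B q N k (i :: v))
  else B.

Section EdgeMap.
Variables (R : realFieldType) (B q : R).
Hypotheses (B_gt1 : 1 < B) (q_gt0 : 0 < q).
Local Notation F := (edge_map B q).
Implicit Types X : R.

Lemma edge_den_gt0 X : 1 <= X -> 0 < X + B + q - 2%:R.
Proof. by move=> X1; have := B_gt1; have := q_gt0; lra. Qed.

Lemma edge_map_mono X X' : 1 <= X -> X <= X' -> F X <= F X'.
Proof.
move=> X1 XX'; have X'1 := le_trans X1 XX'.
rewrite ler_pdivlMr ?edge_den_gt0 // mulrAC ler_pdivrMr ?edge_den_gt0 //.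
rewrite -subr_ge0; have -> : (B * X' + q - 1) * (X + B + q - 2%:R) -
  (B * X + q - 1) * (X' + B + q - 2%:R) = (X' - X) * ((B - 1) * (B + q - 1)) by ring.
by rewrite mulr_ge0 ?mulr_ge0 //; have := B_gt1; have := q_gt0; lra.
Qed.

Lemma edge_map1 : F 1 = 1.
Proof.
rewrite /edge_map; have -> : 1 + B + q - 2%:R = B * 1 + q - 1 by ring.
by rewrite divff // gt_eqF //; have := B_gt1; have := q_gt0; lra.
Qed.

Lemma edge_map_ge1 X : 1 <= X -> 1 <= F X.
Proof. by move=> X1; rewrite -edge_map1 edge_map_mono. Qed.

Lemma edge_map_leB X : 1 <= X -> F X <= B.
Proof.
move=> X1; rewrite ler_pdivrMr ?edge_den_gt0 // -subr_ge0.
have -> : B * (X + B + q - 2%:R) - (B * X + q - 1) = (B - 1) * (B + q - 1) by ring.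
by rewrite mulr_ge0 //; have := B_gt1; have := q_gt0; lra.
Qed.

Lemma prod_ge1 (s : seq nat) (f : nat -> R) :
  (forall i, 1 <= f i) -> 1 <= \prod_(i <- s) f i.
Proof.
move=> f1; elim: s => [|i s IH]; first by rewrite big_nil.
by rewrite big_cons -[X in X <= _]mulr1 ler_pM.
Qed.

Lemma edge_ratio_bounds N n v : 1 <= edge_ratio B q N n v <= B.
Proof.
elim: n v => [|n IH] v /=; first by rewrite ltW //= lexx.
have X1 : 1 <= \prod_(i <- iota 0 (N v)) edge_ratio B q N n (i :: v).
  by apply: prod_ge1 => i; case/andP: (IH (i :: v)).
by rewrite edge_map_ge1 ?edge_map_leB.
Qed.

Lemma edge_ratio_ge1 N n v : 1 <= edge_ratio B q N n v.
Proof. by case/andP: (edge_ratio_bounds N n v). Qed.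

Lemma edge_ratio_leB N n v : edge_ratio B q N n v <= B.
Proof. by case/andP: (edge_ratio_bounds N n v). Qed.

Lemma ler_prod_ge1 (s : seq nat) (f g : nat -> R) : (forall i, 1 <= f i) ->
  (forall i, f i <= g i) -> \prod_(i <- s) f i <= \prod_(i <- s) g i.
Proof.
move=> f1 fg; apply: ler_prod => i _.
by rewrite fg andbT (le_trans _ (f1 i)).
Qed.

Lemma edge_ratio_antimono N n v : edge_ratio B q N n.+1 v <= edge_ratio B q N n v.
Proof.
elim: n v => [|n IH] v; first exact: edge_ratio_leB.
rewrite [X in X <= _]/= [X in _ <= X]/=.
apply: edge_map_mono; first by apply: prod_ge1 => i; exact: (edge_ratio_ge1 N n.+1).
by apply: ler_prod_ge1 => i; [exact: (edge_ratio_ge1 N n.+1) | exact: IH].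
Qed.

(** Ratios are at least 1, so additional children only increase the products. *)
Lemma edge_ratio_mono N N' n v : (forall u, (N u <= N' u)%N) ->
  edge_ratio B q N n v <= edge_ratio B q N' n v.
Proof.
move=> NN'; elim: n v => [|n IH] v //=.
apply: edge_map_mono; first by apply: prod_ge1 => i; exact: edge_ratio_ge1.
rewrite -(subnKC (NN' v)) iotaD big_cat /= -[X in X <= _]mulr1.
rewrite ler_pM //.
- by apply: le_trans (prod_ge1 _ _) => // i; exact: edge_ratio_ge1.
- by apply: ler_prod_ge1 => i; [exact: edge_ratio_ge1 | exact: IH].
- by apply: prod_ge1 => i; exact: edge_ratio_ge1.
Qed.

(** The ratio seen through the edge above v, in terms of partition functions:
    it obeys the tree recursion because both partition functions of v are
    products over its children. *)
Lemma edge_ratioE N k v : let p := 1 - B^-1 in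
  let a := Zhit p q N k v in let b := Zmiss p q N k v in
  [/\ 0 <= a, 0 <= b, 0 < a + b & p * (a + b) + (1 - p) * (a + q * b) =
      edge_ratio B q N k v * (p * b + (1 - p) * (a + q * b))].
Proof.
move=> p; have B0 : 0 < B by apply: lt_trans B_gt1.
have pB : (1 - p) = B^-1 by rewrite /p; ring.
have p0 : 0 < p by rewrite subr_gt0 invf_lt1.
have p1 : 0 < 1 - p by rewrite pB invr_gt0.
have BV : B * B^-1 = 1 by rewrite divff ?gt_eqF.
elim: k v => [|k IH] v.
  rewrite /Zhit /Zmiss /= !(mul1r, mul0r); split => //.
  by rewrite /p; field; rewrite gt_eqF.
pose c i := p * Zmiss p q N k (i :: v) +
            (1 - p) * (Zhit p q N k (i :: v) + q * Zmiss p q N k (i :: v)).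
have c0 i : 0 < c i.
  have [a0 b0 ab _] := IH (i :: v); rewrite /c.
  apply: ltr_wpDl; first by rewrite mulr_ge0 // ltW.
  rewrite mulr_gt0 //; have := q_gt0.
  move: a0 b0 ab; move: (Zhit _ _ _ _ _) (Zmiss _ _ _ _ _) => a b a0 b0 ab q0.
  have [a_gt0|a_le0] := ltP 0 a; first by rewrite ltr_wpDr // mulr_ge0 // ltW.
  by rewrite ltr_wpDl // mulr_gt0 //; lra.
rewrite [edge_ratio _ _ _ _ _]/=.
set X := \prod_(i <- _) _.
set a := Zhit _ _ _ _ _; set b := Zmiss _ _ _ _ _ => /=.
have bE : b = \prod_(i <- iota 0 (N v)) c i by rewrite /b Zmiss_S.
have b_gt0 : 0 < b by rewrite bE; apply: prodr_gt0.
have abE : a + b = X * b.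
  rewrite bE -[in LHS]bE /a /b ZhitD_S /X -big_split /=; apply: eq_bigr => i _.
  by have [_ _ _ ->] := IH (i :: v).
have X1 : 1 <= X by apply: prod_ge1 => i; exact: edge_ratio_ge1.
have aE : a = (X - 1) * b by rewrite mulrBl -abE mul1r addrK.
have a0 : 0 <= a by rewrite aE mulr_ge0 ?subr_ge0 // ltW.
split => //; [exact: ltW | exact: ltr_wpDl |].
have D0 := edge_den_gt0 X1; rewrite pB /edge_map aE /p; field.
by rewrite !gt_eqF.
Qed.

End EdgeMap.

(** Both sides are fractional linear in the ratio of Zhit and Zmiss at the root. From
    here on only the tree recursion matters. *)
Lemma conn_probE (R : realType) (q beta : R) (N : seq nat -> nat) (n : nat) :
  0 < q -> 0 < beta ->
  let Y := edge_ratio (expR beta) q N n [::] in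
  conn_prob N q beta n = (psi q beta)^-1 * ((Y - 1) / (Y - 1 + q)).
Proof.
move=> q0 beta0 Y; have B1 : 1 < expR beta by rewrite expR_gt1.
have [] := edge_ratioE B1 q0 N n [::]; rewrite -/Y.
rewrite /conn_prob /psi expRN rc_connectE.
set a := Zhit _ _ _ _ _; set b := Zmiss _ _ _ _ _ => a0 b0 ab YE.
have Y1 : 1 <= Y by exact: edge_ratio_ge1.
move: YE B1; set B := expR beta => YE B1.
have B0 : B != 0 by rewrite gt_eqF // (lt_trans ltr01).
have {}YE : (B - 1) * (a + b) + (a + q * b) = Y * ((B - 1) * b + (a + q * b)).
  have E x y : (B - 1) * x + y = B * ((1 - B^-1) * x + (1 - (1 - B^-1)) * y).
    by field.
  by rewrite !E YE mulrCA.
have aqb0 : 0 < a + q * b.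
  have [a_gt0|a_le0] := ltP 0 a; first by rewrite ltr_wpDr // mulr_ge0 // ltW.
  by rewrite ltr_wpDl // mulr_gt0 //; lra.
have c0 : 0 < (B - 1) * b + (a + q * b).
  by rewrite ltr_wpDl // mulr_ge0 // subr_ge0 ltW.
have YE1 : Y = ((B - 1) * (a + b) + (a + q * b)) / ((B - 1) * b + (a + q * b)).
  by rewrite YE mulfK // gt_eqF.
have Bq0 : 0 < B + q - 1 by lra.
rewrite YE1; field.
have -> : (B - 1) * (a + b) + (a + q * b) + -1 * ((B - 1) * b + (a + q * b)) +
  q * ((B - 1) * b + (a + q * b)) = (a + q * b) * (B + q - 1) by ring.
rewrite mulf_neq0 ?(gt_eqF aqb0) ?(gt_eqF q0) ?(gt_eqF Bq0) //.
by rewrite subr_eq0 (gt_eqF B1) (gt_eqF c0).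
Qed.

(** * Inequalities for one step of the recursion *)

(** The hyperbolic tangent of half the logarithm of X, which turns products into
    sums up to a nonnegative defect. *)
Definition half_tanh (R : fieldType) (X : R) : R := (X - 1) / (X + 1).

Section OneStep.
Variables (R : realFieldType) (B q : R).
Hypotheses (B_gt1 : 1 < B) (q_gt0 : 0 < q).
Local Notation F := (edge_map B q).
Local Notation slope := ((B - 1) / (B + q - 1)).
Implicit Types X Y s : R.

Lemma half_tanh_bounds X : 1 <= X -> 0 <= half_tanh X <= 1.
Proof.
move=> X1; rewrite divr_ge0 /=; [|lra|lra].
by rewrite ler_pdivrMr; lra.
Qed.

Lemma half_tanh_ge0 X : 1 <= X -> 0 <= half_tanh X.
Proof. by move=> /half_tanh_bounds/andP[]. Qed.

(** The denominators of the two sides differ by (2 - q)(X - 1): this is where the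
    restriction to q at most 2 enters. *)
Lemma half_tanh_edge_map X : q <= 2%:R -> 1 <= X ->
  half_tanh (F X) <= slope * half_tanh X.
Proof.
move=> q2 X1; have D0 := edge_den_gt0 B_gt1 q_gt0 X1.
have BX : B <= B * X by rewrite ler_peMr //; have := B_gt1; lra.
have E0 : 0 < (B + 1) * X + B + 2%:R * q - 3%:R.
  by rewrite mulrDl mul1r; have := B_gt1; have := q_gt0; lra.
have S0 : 0 < (B + q - 1) * (X + 1).
  by rewrite mulr_gt0 //; have := B_gt1; have := q_gt0; lra.
have -> : half_tanh (F X) = (B - 1) * (X - 1) / ((B + 1) * X + B + 2%:R * q - 3%:R).
  rewrite /half_tanh /edge_map; field; rewrite (gt_eqF D0) andbT.
  rewrite -[X in X != 0]addr0 (_ : _ + 0 = (B + 1) * X + B + 2%:R * q - 3%:R); last by ring.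
  by rewrite !gt_eqF.
have -> : slope * half_tanh X = (B - 1) * (X - 1) / ((B + q - 1) * (X + 1)).
  rewrite /half_tanh; field; rewrite !gt_eqF //; have := B_gt1; have := q_gt0; lra.
apply: ler_wpM2l; first by rewrite mulr_ge0 //; have := B_gt1; lra.
rewrite lef_pV2 ?posrE // -subr_ge0.
have -> : (B + 1) * X + B + 2%:R * q - 3%:R - (B + q - 1) * (X + 1) =
  (2%:R - q) * (X - 1) by ring.
by rewrite mulr_ge0 //; lra.
Qed.

(** From the addition formula of the hyperbolic tangent, (a + b) / (1 + a b). *)
Lemma half_tanhM X Y : 1 <= X -> 1 <= Y ->
  half_tanh (X * Y) <=
  half_tanh X + half_tanh Y - half_tanh X ^+ 2 * half_tanh Y / 2%:R.
Proof.
move=> X1 Y1; have /andP[a0 a1] := half_tanh_bounds X1.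
have /andP[b0 b1] := half_tanh_bounds Y1.
have XY0 : 0 <= X * Y by rewrite mulr_ge0 //; lra.
have -> : half_tanh (X * Y) =
    (half_tanh X + half_tanh Y) / (1 + half_tanh X * half_tanh Y).
  rewrite /half_tanh; field.
  have -> : (X + 1) * (Y + 1) + (X - 1) * (Y - 1) = 2%:R * (X * Y + 1) by ring.
  by rewrite mulf_neq0 ?pnatr_eq0 // !gt_eqF //; lra.
move: (half_tanh X) (half_tanh Y) a0 a1 b0 b1 => a b a0 a1 b0 b1.
have ab0 : 0 <= a * b by rewrite mulr_ge0.
have ab1 : a * b <= 1 by rewrite mulr_ile1.
rewrite ler_pdivrMr; last by lra.
rewrite -subr_ge0.
have -> : (a + b - a ^+ 2 * b / 2%:R) * (1 + a * b) - (a + b) =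
  a * b * (a * (1 - a * b) / 2%:R + b) by field.
by rewrite mulr_ge0 // addr_ge0 // !mulr_ge0 //; lra.
Qed.

Lemma half_tanhM_le X Y : 1 <= X -> 1 <= Y ->
  half_tanh (X * Y) <= half_tanh X + half_tanh Y.
Proof.
move=> X1 Y1; apply: le_trans (half_tanhM X1 Y1) _.
rewrite gerBl; apply: divr_ge0 => //; apply: mulr_ge0;
  [apply: exprn_ge0|]; exact: half_tanh_ge0.
Qed.

Lemma half_tanh_prod (s : seq nat) (f : nat -> R) : (forall i, 1 <= f i) ->
  half_tanh (\prod_(i <- s) f i) <= \sum_(i <- s) half_tanh (f i).
Proof.
move=> f1; elim: s => [|i s IH]; first by rewrite !big_nil /half_tanh subrr mul0r.
rewrite !big_cons; apply: le_trans (half_tanhM_le _ _) _ => //; first exact: prod_ge1.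
by rewrite lerD2l.
Qed.

(** The defect of the first two factors is kept, the others being treated by
    subadditivity. *)
Lemma half_tanh_prod_defect (k : nat) (f : nat -> R) : (forall i, 1 <= f i) ->
  half_tanh (\prod_(i <- iota 0 k) f i) <= \sum_(i <- iota 0 k) half_tanh (f i) -
    (1 < k)%N%:R * (half_tanh (f 0%N) ^+ 2 * half_tanh (f 1%N) / 2%:R).
Proof.
move=> f1; case: k => [|[|k]]; try by rewrite mul0r subr0; exact: half_tanh_prod.
rewrite mul1r /= !big_cons mulrA addrA.
have P1 : 1 <= \prod_(i <- iota 2 k) f i by exact: prod_ge1.
apply: le_trans (half_tanhM_le _ P1) _.
  by rewrite -[X in X <= _]mulr1 ler_pM.
rewrite [leRHS]addrAC; apply: lerD; first exact: half_tanhM.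
exact: half_tanh_prod.
Qed.

Lemma edge_map_sub1 X : 1 <= X -> F X - 1 = (B - 1) * (X - 1) / (X + B + q - 2%:R).
Proof.
by move=> X1; rewrite /edge_map; field; rewrite gt_eqF // edge_den_gt0.
Qed.

Lemma slope_gt0 : 0 < slope.
Proof. by rewrite divr_gt0 //; have := B_gt1; have := q_gt0; lra. Qed.

Lemma slope_lt1 : slope < 1.
Proof. by rewrite ltr_pdivrMr; have := B_gt1; have := q_gt0; lra. Qed.

(** The graph of the edge map is concave with slope greater than s at 1; when s is
    positive, dl is the distance at which its chord from 1 has slope s. *)
Lemma edge_map_near1 s : s < slope ->
  exists2 dl, 0 < dl & forall X, 1 <= X -> X <= 1 + dl -> 1 + s * (X - 1) <= F X.
Proof.
move=> ss; have Bq : 0 < B + q - 1 by have := B_gt1; have := q_gt0; lra.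
have [s0|s0] := leP s 0.
  exists 1 => // X X1 _; apply: le_trans (edge_map_ge1 B_gt1 q_gt0 X1).
  by rewrite gerDl mulr_le0_ge0 // subr_ge0.
exists ((B - 1 - s * (B + q - 1)) / s).
  by rewrite divr_gt0 // subr_gt0 -ltr_pdivlMr.
move=> X X1; rewrite -lerBlDl ler_pdivlMr // => Xd.
rewrite -lerBrDl edge_map_sub1 // ler_pdivlMr ?edge_den_gt0 //.
rewrite -subr_ge0; have -> : (B - 1) * (X - 1) - s * (X - 1) * (X + B + q - 2%:R) =
  (X - 1) * (B - 1 - s * (B + q - 1) - (X - 1) * s) by ring.
by rewrite mulr_ge0 ?subr_ge0.
Qed.

(** The edge map does not flatten near 1, so that a value close to 1 forces its
    argument to be close to 1. *)
Lemma edge_map_expand c X dl : 0 <= dl -> 2%:R * dl <= B - 1 -> 1 <= X ->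
  F X <= 1 + dl -> 2%:R <= c * slope -> X <= 1 + c * dl.
Proof.
move=> dl0 dlB X1; have Bq : 0 < B + q - 1 by have := B_gt1; have := q_gt0; lra.
rewrite -lerBlDl edge_map_sub1 // ler_pdivrMr ?edge_den_gt0 // => FX.
rewrite mulrA ler_pdivlMr // => cs; rewrite -lerBlDl.
have c2 : 2%:R * (B + q - 1) * dl <= c * (B - 1) * dl by rewrite ler_wpM2r.
have BX : 2%:R * dl * (X - 1) <= (B - 1) * (X - 1) by rewrite ler_wpM2r // subr_ge0.
have B10 : 0 < B - 1 by rewrite subr_gt0.
rewrite -(ler_pM2l B10); lra.
Qed.

End OneStep.

(** The percolation inequality with the edge map replaced by the line of slope s
    through its fixed point 1. It is an equality for C = 0, and the right-hand side
    does not decrease with C. *)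
Lemma percolation_power (R : realFieldType) (s X : R) (C : nat) :
  0 < s -> s < 1 -> 1 <= X ->
  1 <= (1 + s * (X - 1)) ^+ C * (1 - s + s * X^-1 ^+ C).
Proof.
move=> s0 s1 X1; have X0 : 0 < X by apply: lt_le_trans X1.
elim: C => [|C IH]; first by rewrite !expr0 mul1r mulr1 subrK.
apply: le_trans IH _; rewrite !exprSr -mulrA ler_wpM2l //.
  by rewrite exprn_ge0 // addr_ge0 // mulr_ge0 ?(ltW s0) ?subr_ge0.
set y := X^-1 ^+ C.
have y1 : y <= 1 by rewrite exprn_ile1 ?invr_ge0 ?invf_le1 // ltW.
rewrite -subr_ge0.
have -> : (1 + s * (X - 1)) * (1 - s + s * (y * X^-1)) - (1 - s + s * y) =
  s * (1 - s) * (X - 1) * (1 - y * X^-1) by field; rewrite gt_eqF.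
rewrite !mulr_ge0 ?subr_ge0 ?(ltW s0) ?(ltW s1) //.
by rewrite ler_pdivrMr // mul1r (le_trans y1).
Qed.

(** Inverse powers of the ratio behave like survival probabilities: after one
    step the complement to 1 is multiplied by at least s, as in a percolation
    with retention probability s. Near 1 the tangent line is enough; away from 1
    the left-hand side is below 1 - s once C is large. *)
Lemma edge_map_percolation (R : archiRealFieldType) (B q s : R) :
  1 < B -> 0 < q -> 0 < s -> s < (B - 1) / (B + q - 1) -> exists2 C : nat,
  (0 < C)%N & forall X, 1 <= X -> (edge_map B q X)^-1 ^+ C <= 1 - s + s * X^-1 ^+ C.
Proof.
move=> B1 q0 s0 ss; have s1 : s < 1 := lt_trans ss (slope_lt1 B1 q0).
have [dl dl0 dlP] := edge_map_near1 B1 q0 ss.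
have sd0 : 0 < s * dl by rewrite mulr_gt0.
have [C CP] : exists C : nat, (1 - s)^-1 <= C%:R * (s * dl).
  exists (Num.trunc ((1 - s)^-1 / (s * dl))).+1.
  by rewrite -ler_pdivrMr //; apply/ltW; exact: truncnS_gt.
exists C => [|X X1].
  rewrite lt0n; apply: contraTneq CP => ->.
  by rewrite mul0r -ltNge invr_gt0 subr_gt0.
have FX1 : 1 <= edge_map B q X := edge_map_ge1 B1 q0 X1.
have FX0 : 0 < edge_map B q X by apply: lt_le_trans FX1.
have X0 : 0 < X by apply: lt_le_trans X1.
rewrite exprVn -[X in X <= _]mul1r ler_pdivrMr ?exprn_gt0 // mulrC.
have y0 : 0 <= s * X^-1 ^+ C by rewrite mulr_ge0 ?exprn_ge0 ?invr_ge0 // ltW.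
have [Xd|/ltW Xd] := leP X (1 + dl).
  apply: le_trans (percolation_power C s0 s1 X1) _.
  rewrite ler_wpM2r //; first by rewrite addr_ge0 // subr_ge0 ltW.
  rewrite lerXn2r ?nnegrE ?(ltW FX0) //; last exact: dlP.
  by rewrite addr_ge0 // mulr_ge0 ?(ltW s0) // subr_ge0.
(* far from 1, the ratio itself is already large *)
have Fd : 1 + s * dl <= edge_map B q X.
  apply: le_trans (edge_map_mono B1 q0 _ Xd); last by rewrite lerDl ltW.
  apply: le_trans (dlP (1 + dl) _ (lexx _)); last by rewrite lerDl ltW.
  by rewrite addrAC subrr add0r.
have CF : (1 - s)^-1 <= edge_map B q X ^+ C.
  apply: le_trans CP _; apply: (@le_trans _ _ ((1 + s * dl) ^+ C)).
    elim: C {y0} => [|C IH]; first by rewrite mul0r expr0.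
    rewrite exprS mulrDl mul1r -natr1 mulrDl mul1r.
    apply: lerD => //; rewrite ler_peMr ?(ltW sd0) //.
    by rewrite exprn_ege1 // lerDl ltW.
  by rewrite lerXn2r ?nnegrE ?(ltW FX0) // addr_ge0 // ltW.
apply: (@le_trans _ _ ((1 - s)^-1 * (1 - s))).
  by rewrite mulVf // gt_eqF // subr_gt0.
rewrite ler_pM ?invr_ge0 ?subr_ge0 ?(ltW s1) //; lra.
Qed.

(** * Galton-Watson trees with bounded offspring *)

(** A set of coordinates, independent of the offspring numbers, that determines the
    ratio at v when these numbers are at most K. *)
Definition ratio_words (K n : nat) (v : seq nat) : seq (seq nat) :=
  if n is k.+1 then v :: below (fun=> K) k v else [::].

Lemma ratio_wordsS K n v : ratio_words K n.+1 v =
  v :: flatten [seq ratio_words K n (i :: v) | i <- iota 0 K].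
Proof. by case: n => //=; elim: (iota 0 K) => //= i s <-. Qed.

Lemma below_cat K k (u v : seq nat) :
  below (fun=> K) k (u ++ v) = [seq x ++ v | x <- below (fun=> K) k u].
Proof.
elim: k u => //= k IH u; rewrite map_flatten -map_comp; congr flatten.
by apply: eq_map => i /=; rewrite -(IH (i :: u)).
Qed.

Lemma ratio_words_cat K n v :
  ratio_words K n v = [seq x ++ v | x <- ratio_words K n [::]].
Proof. by case: n => //= n; rewrite -below_cat. Qed.

Lemma ratio_words_disjoint K n v (i j : nat) : i != j ->
  ~~ has (mem (ratio_words K n (i :: v))) (ratio_words K n (j :: v)).
Proof. by case: n => //= n; apply: child_disjoint. Qed.

Lemma notin_ratio_children K n v :
  v \notin flatten [seq ratio_words K n (i :: v) | i <- iota 0 K].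
Proof.
case: n => [|n]; first by elim: (iota 0 K).
exact: (@notin_below (fun=> K) n.+1 v).
Qed.

Lemma uniq_ratio_words K n v : uniq (ratio_words K n v).
Proof. by case: n => //= n; rewrite notin_below uniq_below. Qed.

Lemma wsum_upd (R : comPzRingType) (I : eqType) (T : finType) (wt : T -> R)
    (s : seq I) (Phi : (I -> T) -> R) e v k : v \notin s ->
  wsum wt s Phi (upd e v k) = wsum wt s (fun e' => Phi (upd e' v k)) e.
Proof.
elim: s e => //= u s IH e; rewrite inE negb_or => /andP[vu vs].
by apply: eq_bigr => l _; rewrite upd_swap // IH.
Qed.

Lemma edge_ratio_cat (R : fieldType) (B q : R) N n (u v : seq nat) :
  edge_ratio B q N n (u ++ v) = edge_ratio B q (N \o cat^~ v) n u.
Proof.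
elim: n u => //= n IH u; congr edge_map; apply: eq_bigr => i _.
exact: (IH (i :: u)).
Qed.

Section Truncated.
Variables (R : realFieldType) (B q : R) (K : nat) (wt : 'I_K.+1 -> R).
Hypotheses (B_gt1 : 1 < B) (q_gt0 : 0 < q).
Hypotheses (wt_ge0 : forall k, 0 <= wt k) (wt_sum : \sum_k wt k = 1).
Implicit Types (phi : R -> R) (e : seq nat -> 'I_K.+1).

Definition ratio (n : nat) (v : seq nat) e : R :=
  edge_ratio B q (fun u => e u : nat) n v.

Lemma ratio_ge1 n v e : 1 <= ratio n v e.
Proof. exact: edge_ratio_ge1. Qed.

Lemma depends_ratio n v : depends_on (ratio_words K n v) (ratio n v).
Proof.
elim: n v => [|n IH] v e e' ee'; first by [].
rewrite /ratio /= -/(ratio n) ee'; last by rewrite ratio_wordsS mem_head.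
congr edge_map; apply: eq_big_seq => i; rewrite mem_iota add0n => /= ik.
apply: IH => u uS; apply: ee'; rewrite ratio_wordsS inE; apply/orP; right.
apply/flattenP; exists (ratio_words K n (i :: v)) => //; apply: map_f.
by rewrite mem_iota add0n (leq_trans ik) // -ltnS.
Qed.

(** The expectation of phi at the ratio of the root, for the Galton-Watson tree with
    offspring law wt. *)
Definition root_mean (n : nat) (phi : R -> R) : R :=
  wsum wt (ratio_words K n [::]) (fun e => phi (ratio n [::] e)) (fun=> ord0).

(** The subtree of v has the law of the whole tree. *)
Lemma root_meanE n v phi :
  wsum wt (ratio_words K n v) (fun e => phi (ratio n v e)) (fun=> ord0) =
  root_mean n phi.
Proof.
have inj : injective (fun x => x ++ v).
  apply: (can_inj (g := fun z => take (size z - size v) z)) => x.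
  by rewrite size_cat addnK take_size_cat.
rewrite ratio_words_cat -[RHS](wsum_comp _ _ _ (fun=> ord0) inj).
by apply: eq_wsum => e; rewrite /ratio -[v in LHS]cat0s edge_ratio_cat.
Qed.

Lemma root_mean0 phi : root_mean 0 phi = phi B.
Proof. by []. Qed.

Lemma eq_root_mean n phi phi' : (forall y, 1 <= y -> phi y = phi' y) ->
  root_mean n phi = root_mean n phi'.
Proof. by move=> h; apply: eq_wsum => e; apply: h; exact: ratio_ge1. Qed.

Lemma ler_root_mean n phi phi' : (forall y, 1 <= y -> phi y <= phi' y) ->
  root_mean n phi <= root_mean n phi'.
Proof. by move=> h; apply: ler_wsum => // e; apply: h; exact: ratio_ge1. Qed.

Lemma root_mean_ge0 n phi : (forall y, 1 <= y -> 0 <= phi y) -> 0 <= root_mean n phi.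
Proof. by move=> h; apply: wsum_ge0 => // e; apply: h; exact: ratio_ge1. Qed.

Lemma root_mean_cst n c : root_mean n (fun=> c) = c.
Proof. exact: wsum_cst wt_sum. Qed.

Lemma root_meanZ n c phi : root_mean n (fun y => c * phi y) = c * root_mean n phi.
Proof. exact: wsumZ. Qed.

Definition children_words (n : nat) : seq (seq nat) :=
  flatten [seq ratio_words K n [:: i] | i <- iota 0 K].

(** The expectation over the subtrees of K potential children of the root. *)
Definition children_mean (n : nat) (Phi : (nat -> R) -> R) : R :=
  wsum wt (children_words n) (fun e => Phi (fun i => ratio n [:: i] e)) (fun=> ord0).

(** Conditioning on the offspring number of the root. *)
Lemma root_meanS n phi : root_mean n.+1 phi = \sum_k wt k *
  children_mean n (fun y => phi (edge_map B q (\prod_(i <- iota 0 k) y i))).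
Proof.
rewrite /root_mean ratio_wordsS /=; apply: eq_bigr => k _.
rewrite wsum_upd ?notin_ratio_children //; congr (_ * _); apply: eq_wsum => e.
rewrite /ratio /= -/(ratio n) {1}/upd eqxx; congr (phi (edge_map _ _ _)).
apply: eq_big_seq => i; rewrite mem_iota add0n => /= ik.
apply: depends_ratio => u ui; rewrite /upd; case: eqP => // u0.
have /negP[] := notin_ratio_children K n [::]; rewrite -{1}u0; apply/flattenP.
exists (ratio_words K n [:: i]) => //; apply: map_f.
by rewrite mem_iota add0n (leq_trans ik) // -ltnS.
Qed.

(** The subtrees of the children of the root are independent copies. *)
Lemma children_mean_prod n (g : nat -> R -> R) :
  children_mean n (fun y => \prod_(i <- iota 0 K) g i (y i)) =
  \prod_(i <- iota 0 K) root_mean n (g i).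
Proof.
rewrite /children_mean wsum_prod ?iota_uniq //.
- by apply: eq_bigr => i _; apply: root_meanE.
- by move=> i _ e e' ee'; rewrite (depends_ratio ee').
- by move=> i j _ _; apply: ratio_words_disjoint.
Qed.

(** The subtrees of the K - k missing children integrate to 1. *)
Lemma children_mean_expr n k g : (k <= K)%N ->
  children_mean n (fun y => \prod_(i <- iota 0 k) g (y i)) = root_mean n g ^+ k.
Proof.
move=> kK.
have cut (V : nat -> R) : \prod_(i <- iota 0 k) V i =
    \prod_(i <- iota 0 K) (if (i < k)%N then V i else 1).
  rewrite -(subnKC kK) iotaD big_cat /= [X in _ = _ * X]big1_seq ?mulr1.
    by apply: eq_big_seq => i; rewrite mem_iota add0n => /= ->.
  by move=> i /=; rewrite add0n mem_iota => /andP[ki _]; rewrite ltnNge ki.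
transitivity (children_mean n
   (fun y => \prod_(i <- iota 0 K) (if (i < k)%N then g else fun=> 1) (y i))).
  apply: eq_wsum => e; rewrite cut; apply: eq_bigr => i _.
  by case: ifP.
rewrite (children_mean_prod n (fun i => if (i < k)%N then g else fun=> 1)).
transitivity (\prod_(i <- iota 0 K) (if (i < k)%N then root_mean n g else 1)).
  by apply: eq_bigr => i _; case: ifP => // _; apply: root_mean_cst.
by rewrite -cut big_const_seq count_predT size_iota iter_mulr_1.
Qed.

Lemma children_mean1 n j g : (j < K)%N ->
  children_mean n (fun y => g (y j)) = root_mean n g.
Proof.
move=> jK; have jI : j \in iota 0 K by rewrite mem_iota.
transitivity (children_mean n
   (fun y => \prod_(i <- iota 0 K) (if i == j then g else fun=> 1) (y i))).
  apply: eq_wsum => e; rewrite (big_rem j) //= eqxx big1_seq ?mulr1 // => i /=.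
  by rewrite mem_rem_uniq ?iota_uniq // inE => /andP[/negPf ->].
rewrite (children_mean_prod n (fun i => if i == j then g else fun=> 1)).
rewrite (big_rem j) //= eqxx big1_seq ?mulr1 // => i /=.
rewrite mem_rem_uniq ?iota_uniq // inE => /andP[/negPf -> _].
exact: root_mean_cst.
Qed.

Lemma children_mean2 n g h : (1 < K)%N ->
  children_mean n (fun y => g (y 0%N) * h (y 1%N)) = root_mean n g * root_mean n h.
Proof.
move=> K1; have iotaE : iota 0 K = [:: 0, 1 & iota 2 K.-2]%N.
  by case: (K) K1 => [|[]].
pose G i := if i == 0%N then g else if i == 1%N then h else fun=> 1.
have tail (V : nat -> R) : (forall i, (1 < i)%N -> V i = 1) ->
    \prod_(i <- iota 2 K.-2) V i = 1.
  by move=> V1; rewrite big1_seq // => i /=; rewrite mem_iota => /andP[/V1].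
transitivity (children_mean n (fun y => \prod_(i <- iota 0 K) G i (y i))).
  apply: eq_wsum => e; rewrite iotaE !big_cons tail ?mulr1 //.
  by case=> [|[]].
rewrite children_mean_prod iotaE !big_cons tail ?mulr1 //.
by case=> [|[]] // i _; apply: root_mean_cst.
Qed.

End Truncated.

(** * Decay at and below the critical slope *)

Section Subcritical.
Variables (R : realFieldType) (B q : R) (K : nat) (wt : 'I_K.+1 -> R).
Hypotheses (B_gt1 : 1 < B) (q_gt0 : 0 < q) (q_le2 : q <= 2%:R).
Hypotheses (wt_ge0 : forall k, 0 <= wt k) (wt_sum : \sum_(k < K.+1) wt k = 1).
Hypothesis K_gt1 : (1 < K)%N.
Local Notation slope := ((B - 1) / (B + q - 1)).
Local Notation mean := (root_mean B q wt).
Local Notation l n := (mean n (@half_tanh R)).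

Let mu_ge2 := \sum_(k < K.+1) (1 < k)%N%:R * wt k.

Lemma ler_children_mean n (Phi Psi : (nat -> R) -> R) :
  (forall y, (forall i, 1 <= y i) -> Phi y <= Psi y) ->
  children_mean B q wt n Phi <= children_mean B q wt n Psi.
Proof. by move=> h; apply: ler_wsum => // e; apply: h => i; exact: ratio_ge1. Qed.

Lemma root_mean_jensen n : (l n) ^+ 2 <= mean n (fun y => half_tanh y ^+ 2).
Proof.
have : 0 <= mean n (fun y => (half_tanh y - l n) ^+ 2).
  by apply: root_mean_ge0 => // y _; exact: sqr_ge0.
have -> : mean n (fun y => (half_tanh y - l n) ^+ 2) =
  mean n (fun y => half_tanh y ^+ 2) - (l n) ^+ 2; last by rewrite subr_ge0.
transitivity (mean n (fun y =>
    half_tanh y ^+ 2 + ((- 2%:R * l n) * half_tanh y + (l n) ^+ 2))).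
  by apply: eq_root_mean => // y _; ring.
rewrite /root_mean !wsumD wsumZ wsum_cst // -!/(root_mean _ _ _ _ _); ring.
Qed.

Lemma half_tanh_mean_ge0 n : 0 <= l n.
Proof. by apply: root_mean_ge0 => // y y1; exact: half_tanh_ge0. Qed.

(** At criticality the linear bound only keeps the mean from increasing; it is the
    defect produced by two independent siblings that makes it decrease. *)
Lemma half_tanh_mean_step n : slope * \sum_(k < K.+1) k%:R * wt k <= 1 ->
  l n.+1 <= l n - slope * mu_ge2 / 2%:R * (l n) ^+ 3.
Proof.
move=> crit; have sl0 := slope_gt0 B_gt1 q_gt0.
rewrite root_meanS //.
apply: (@le_trans _ _ (\sum_(k < K.+1) wt k * (slope *
   (k%:R * l n - (1 < k)%N%:R * (l n ^+ 3 / 2%:R))))).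
  apply: ler_sum => k _; apply: ler_wpM2l => //.
  apply: (@le_trans _ _ (children_mean B q wt n (fun y => slope *
     (\sum_(i <- iota 0 k) half_tanh (y i) -
      ((1 < k)%N%:R / 2%:R) * (half_tanh (y 0%N) ^+ 2 * half_tanh (y 1%N)))))).
    apply: ler_children_mean => y y1.
    apply: le_trans (half_tanh_edge_map B_gt1 q_gt0 q_le2 _) _; first exact: prod_ge1.
    apply: ler_wpM2l; first exact: ltW.
    apply: le_trans (half_tanh_prod_defect k y1) _.
    by rewrite lerD2l lerN2 le_eqVlt; apply/orP; left; apply/eqP; ring.
  rewrite /children_mean wsumZ wsumB wsum_sum wsumZ ler_wpM2l ?(ltW sl0) //.
  apply: lerB.
    rewrite le_eqVlt; apply/orP; left; apply/eqP.
    rewrite (eq_big_seq (fun=> l n)) => [|i].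
      by rewrite big_const_seq count_predT size_iota iter_addr_0 mulr_natl.
    rewrite mem_iota add0n => /= ik.
    by apply: (children_mean1 B q wt_sum n (@half_tanh R));
      rewrite (leq_trans ik) // -ltnS.
  rewrite -/(children_mean B q wt n (fun y => half_tanh (y 0%N) ^+ 2 * half_tanh (y 1%N))).
  rewrite (children_mean2 B q wt_sum n (fun y => half_tanh y ^+ 2) (@half_tanh R) K_gt1).
  have -> : (1 < k)%N%:R * (l n ^+ 3 / 2%:R) = (1 < k)%N%:R / 2%:R * (l n ^+ 2 * l n) by ring.
  apply: ler_wpM2l; first by rewrite divr_ge0.
  by apply: ler_wpM2r; [exact: half_tanh_mean_ge0 | exact: root_mean_jensen].
have -> : \sum_(k < K.+1) wt k * (slope * (k%:R * l n - (1 < k)%N%:R * (l n ^+ 3 / 2%:R))) =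
    (slope * \sum_(k < K.+1) k%:R * wt k) * l n - slope * mu_ge2 / 2%:R * l n ^+ 3.
  have -> : slope * mu_ge2 / 2%:R * l n ^+ 3 = slope * (l n ^+ 3 / 2%:R) * mu_ge2 by ring.
  have -> (x : R) : slope * x * l n = slope * l n * x by ring.
  rewrite /mu_ge2 !mulr_sumr -sumrB; apply: eq_bigr => k _; ring.
by rewrite lerD2r -[leRHS]mul1r ler_wpM2r // half_tanh_mean_ge0.
Qed.

(** As long as the mean exceeds eps, each generation lowers it by c * eps ^ 3, and
    it starts below 1. When c is chosen independently of K the bound is uniform in
    K, which allows the truncation to be removed at the end. *)
Lemma half_tanh_mean_decay (c eps : R) n : slope * \sum_(k < K.+1) k%:R * wt k <= 1 ->
  0 <= c -> c <= slope * mu_ge2 / 2%:R -> 0 < eps ->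
  1 <= n%:R * (c * eps ^+ 3) -> l n <= eps.
Proof.
move=> crit c0 cc eps0.
have step k : l k.+1 <= l k - c * (l k) ^+ 3.
  apply: le_trans (half_tanh_mean_step k crit) _.
  by rewrite lerD2l lerN2 ler_wpM2r // exprn_ge0 // half_tanh_mean_ge0.
have alt k : l k <= eps \/ l k <= 1 - k%:R * (c * eps ^+ 3).
  elim: k => [|k [IH|IH]].
  - right; rewrite mul0r subr0 root_mean0.
    by have /andP[] := half_tanh_bounds (ltW B_gt1).
  - left; apply: le_trans IH; apply: le_trans (step k) _.
    by rewrite gerBl mulr_ge0 // exprn_ge0 // half_tanh_mean_ge0.
  - have [le|gt] := leP (l k) eps.
      left; apply: le_trans le; apply: le_trans (step k) _.
      by rewrite gerBl mulr_ge0 // exprn_ge0 // half_tanh_mean_ge0.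
    right; apply: le_trans (step k) _; rewrite -natr1 mulrDl mul1r opprD addrA.
    apply: lerB => //; apply: ler_wpM2l => //.
    by rewrite lerXn2r ?nnegrE ?half_tanh_mean_ge0 // ltW.
case: (alt n) => // ln n1; apply: le_trans ln _.
by apply: le_trans (ltW eps0); rewrite subr_le0.
Qed.

Lemma root_mean_markov n (dl : R) : 0 < dl ->
  mean n (fun y => (1 + dl <= y)%R%:R) <= (2%:R + dl) / dl * l n.
Proof.
move=> dl0; rewrite -root_meanZ //; apply: ler_root_mean => // y y1.
have t0 := half_tanh_ge0 y1; case: (leP (1 + dl) y) => [dy|_].
    rewrite /half_tanh mulrA ler_pdivlMr; last by lra.
  rewrite mul1r mulrAC ler_pdivlMr //.
  by rewrite -subr_ge0; nra.
by rewrite mulr_ge0 // divr_ge0 // ltW // addr_gt0.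
Qed.

End Subcritical.

(** * Survival above the critical slope *)

Section Supercritical.
Variables (R : archiRealFieldType) (B q : R) (K : nat) (wt : 'I_K.+1 -> R).
Hypotheses (B_gt1 : 1 < B) (q_gt0 : 0 < q).
Hypotheses (wt_ge0 : forall k, 0 <= wt k) (wt_sum : \sum_(k < K.+1) wt k = 1).
Hypotheses (wt0 : wt ord0 = 0).
Local Notation slope := ((B - 1) / (B + q - 1)).
Local Notation mean := (root_mean B q wt).
Local Notation near1 dl := (fun y : R => (y <= 1 + dl)%R%:R : R).

Lemma root_mean_percolation_step (s : R) C n : 0 <= s ->
  (forall X, 1 <= X -> (edge_map B q X)^-1 ^+ C <= 1 - s + s * X^-1 ^+ C) ->
  mean n.+1 (fun y => y^-1 ^+ C) <=
  1 - s + s * \sum_(k < K.+1) wt k * mean n (fun y => y^-1 ^+ C) ^+ k.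
Proof.
move=> s0 FC; rewrite root_meanS //.
have -> : 1 - s + s * \sum_(k < K.+1) wt k * mean n (fun y => y^-1 ^+ C) ^+ k =
    \sum_(k < K.+1) wt k * (1 - s + s * mean n (fun y => y^-1 ^+ C) ^+ k).
  under [RHS]eq_bigr => k _ do rewrite mulrDr mulrCA.
  by rewrite big_split /= -mulr_suml wt_sum mul1r -mulr_sumr.
apply: ler_sum => k _; apply: ler_wpM2l => //.
have kK : (k <= K)%N by rewrite -ltnS.
rewrite -(children_mean_expr B q wt_sum n _ kK).
apply: (@le_trans _ _ (children_mean B q wt n (fun y =>
    (1 - s) + s * \prod_(i <- iota 0 k) (y i)^-1 ^+ C))).
  apply: ler_children_mean => // y y1.
  apply: le_trans (FC _ _) _; first exact: prod_ge1.
  by rewrite -prodfV prodrXl.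
by rewrite /children_mean wsumD wsumZ wsum_cst.
Qed.

Lemma bernoulli_inequality (x : R) k : 0 <= x <= 1 -> 1 - k%:R * x <= (1 - x) ^+ k.
Proof.
case/andP=> x0 x1; elim: k => [|k IH]; first by rewrite mul0r subr0.
rewrite exprS; apply: (@le_trans _ _ ((1 - x) * (1 - k%:R * x))).
  rewrite -subr_ge0 -natr1.
  have -> : (1 - x) * (1 - k%:R * x) - (1 - (k%:R + 1) * x) = k%:R * (x * x) by ring.
  by rewrite !mulr_ge0.
by rewrite ler_wpM2l // subr_ge0.
Qed.

Lemma one_sub_expr (x : R) k L : 0 <= x <= 1 -> (k <= L)%N ->
  k%:R * x * (1 - x) ^+ L <= 1 - (1 - x) ^+ k.
Proof.
case/andP=> x0 x1; elim: k => [|k IH] kL; first by rewrite !mul0r expr0 subrr.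
have xk : (1 - x) ^+ L <= (1 - x) ^+ k.
  by apply: ler_wiXn2l; rewrite ?subr_ge0 ?gerBl // ltnW.
have -> : 1 - (1 - x) ^+ k.+1 = 1 - (1 - x) ^+ k + x * (1 - x) ^+ k.
  by rewrite exprS; ring.
have -> : k.+1%:R * x * (1 - x) ^+ L = k%:R * x * (1 - x) ^+ L + x * (1 - x) ^+ L.
  by rewrite -natr1; ring.
by apply: lerD; [exact: IH (ltnW kL) | exact: ler_wpM2l].
Qed.

(** A percolation whose mean offspring exceeds 1 survives with positive
    probability: its generating function has slope greater than 1 at 1, so it maps
    the interval from 0 to 1 - x into itself for x small. *)
Lemma percolation_fixed_point (s b : R) : 0 < s -> s < 1 -> b < 1 ->
  1 < s * \sum_(k < K.+1) k%:R * wt k ->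
  exists x, [/\ 0 < x, x < 1, b <= 1 - x &
    forall u, 0 <= u -> u <= 1 - x -> 1 - s + s * \sum_(k < K.+1) wt k * u ^+ k <= 1 - x].
Proof.
move=> s0 s1 b1 sM; set M := \sum_(k < K.+1) _ in sM.
have M0 : 0 < M by rewrite -(pmulr_rgt0 _ s0) (lt_trans ltr01).
have sM0 : 0 < s * M by exact: lt_trans sM.
have K1 : 0 < K.+1%:R :> R by rewrite ltr0n.
pose z := (1 - (s * M)^-1) / K.+1%:R.
have z0 : 0 < z by rewrite divr_gt0 // subr_gt0 invf_lt1.
pose x := Num.min (2%:R^-1) (Num.min z (1 - b)).
have x0 : 0 < x by rewrite !lt_min z0 subr_gt0 b1 invr_gt0 ltr0n.
have x12 : x <= 2%:R^-1 by rewrite ge_min lexx.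
have xz : x <= z by rewrite !ge_min lexx orbT.
have xb : x <= 1 - b by rewrite !ge_min lexx !orbT.
have x1 : x < 1 by apply: le_lt_trans x12 _; rewrite invf_lt1 ?ltr1n.
exists x; split => //; first by lra.
move=> u u0 ux.
have uk k : u ^+ k <= (1 - x) ^+ k by rewrite lerXn2r ?nnegrE // subr_ge0 ltW.
have -> : 1 - s + s * \sum_(k < K.+1) wt k * u ^+ k =
    1 - s * \sum_(k < K.+1) wt k * (1 - u ^+ k).
  have -> : \sum_(k < K.+1) wt k * (1 - u ^+ k) = 1 - \sum_(k < K.+1) wt k * u ^+ k.
    rewrite -[in RHS]wt_sum -sumrB; apply: eq_bigr => k _; ring.
  ring.
rewrite lerD2l lerN2.
have le1 : M * (x * (1 - x) ^+ K) <= \sum_(k < K.+1) wt k * (1 - u ^+ k).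
  rewrite mulr_suml; apply: ler_sum => k _; rewrite [k%:R * _]mulrC -mulrA.
  apply: ler_wpM2l => //; apply: (@le_trans _ _ (1 - (1 - x) ^+ k)).
    rewrite mulrA; apply: one_sub_expr; first by rewrite !ltW.
    by rewrite -ltnS.
  by rewrite lerD2l lerN2.
apply: le_trans (ler_wpM2l (ltW s0) le1).
have -> : s * (M * (x * (1 - x) ^+ K)) = x * (s * M * (1 - x) ^+ K) by ring.
rewrite ler_peMr ?(ltW x0) //.
have xK : (s * M)^-1 <= (1 - x) ^+ K.
  apply: le_trans (bernoulli_inequality K _); last by rewrite !ltW.
  have : x * K.+1%:R <= 1 - (s * M)^-1 by rewrite -ler_pdivlMr.
  rewrite -natr1 mulrDr mulr1 => h.
  have -> : K%:R * x = x * K%:R by rewrite mulrC.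
  lra.
by rewrite -(ler_pdivrMl _ _ sM0) mulr1.
Qed.

Lemma expr_near1 (C : nat) (x : R) : 0 < x -> exists2 dl, 0 < dl &
  (1 + dl) ^+ C <= 1 + x.
Proof.
move=> x0; pose dl := Num.min 1 (x / 3%:R ^+ C).
have t0 : 0 < 3%:R ^+ C :> R by rewrite exprn_gt0.
have dl0 : 0 < dl by rewrite lt_min ltr01 divr_gt0.
have dl1 : dl <= 1 by rewrite ge_min lexx.
have dlx : 3%:R ^+ C * dl <= x by rewrite mulrC -ler_pdivlMr // ge_min lexx orbT.
have key j : (1 + dl) ^+ j <= 1 + 3%:R ^+ j * dl.
  elim: j => [|j IH]; first by rewrite !expr0 mul1r lerDl ltW.
  rewrite exprS; apply: (@le_trans _ _ ((1 + dl) * (1 + 3%:R ^+ j * dl))).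
    by rewrite ler_wpM2l // addr_ge0 // ltW.
  have t1 : 1 <= 3%:R ^+ j :> R by rewrite exprn_ege1 // ler1n.
  rewrite exprS -subr_ge0.
  have -> : 1 + 3%:R * 3%:R ^+ j * dl - (1 + dl) * (1 + 3%:R ^+ j * dl) =
    dl * ((3%:R ^+ j - 1) + 3%:R ^+ j * (1 - dl)) by ring.
  by rewrite mulr_ge0 ?(ltW dl0) // addr_ge0 ?mulr_ge0 ?subr_ge0 // (le_trans ler01).
by exists dl => //; apply: le_trans (key C) _; rewrite lerD2l.
Qed.

Lemma expr_small (x eps : R) : 0 <= x -> x < 1 -> 0 < eps ->
  exists j : nat, x ^+ j <= eps.
Proof.
move=> x0 x1 eps0; have h0 : 0 < 1 - x by rewrite subr_gt0.
have key j : x ^+ j * (1 + j%:R * (1 - x)) <= 1.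
  elim: j => [|j IH]; first by rewrite expr0 mul0r addr0 mulr1.
  apply: le_trans IH; rewrite exprSr -mulrA ler_wpM2l ?exprn_ge0 //.
  rewrite -subr_ge0 -natr1.
  have -> : 1 + j%:R * (1 - x) - x * (1 + (j%:R + 1) * (1 - x)) =
    (j%:R + 1) * (1 - x) ^+ 2 by ring.
  by rewrite mulr_ge0 ?sqr_ge0 // addr_ge0.
pose j := (Num.trunc (eps^-1 / (1 - x))).+1; exists j.
have jx : eps^-1 <= 1 + j%:R * (1 - x).
  apply: le_trans (_ : j%:R * (1 - x) <= _); last by rewrite lerDr.
  by rewrite -ler_pdivrMr //; apply/ltW/truncnS_gt.
have D0 : 0 < 1 + j%:R * (1 - x) by apply: lt_le_trans jx; rewrite invr_gt0.
apply: le_trans (_ : (1 + j%:R * (1 - x))^-1 <= _).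
  by rewrite -[leRHS]mul1r ler_pdivlMr.
by rewrite invf_ple ?posrE.
Qed.

Lemma near1_mono n (dl dl' : R) : dl <= dl' -> mean n (near1 dl) <= mean n (near1 dl').
Proof.
move=> dd; apply: ler_root_mean => // y _; rewrite ler_nat.
by case: (leP y (1 + dl)) => // h; rewrite (le_trans h) // lerD2l.
Qed.

Lemma near1_ge0 n dl : 0 <= mean n (near1 dl).
Proof. by apply: root_mean_ge0 => // y _; rewrite ler0n. Qed.

Lemma near1_le1 n dl : mean n (near1 dl) <= 1.
Proof.
rewrite -[leRHS](root_mean_cst B q wt_sum n 1); apply: ler_root_mean => // y _.
by rewrite lern1 leq_b1.
Qed.

(** The mean of the C-th inverse power of the ratio stays below 1 - x, a bound
    that the percolation recursion preserves; Markov's inequality does the rest. *)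
Lemma near1_mean_lt1 : 1 < slope * \sum_(k < K.+1) k%:R * wt k ->
  exists dl t, [/\ 0 < dl, 0 <= t, t < 1 & forall n, mean n (near1 dl) <= t].
Proof.
move=> super; set M := \sum_(k < K.+1) _ in super.
have sl0 := slope_gt0 B_gt1 q_gt0.
have M0 : 0 < M by rewrite -(pmulr_rgt0 _ sl0) (lt_trans ltr01).
have Ms : M^-1 < slope by rewrite -(ltr_pM2r M0) mulVf ?gt_eqF.
pose s := (M^-1 + slope) / 2%:R.
have MV0 : 0 < M^-1 by rewrite invr_gt0.
have Ms' : M^-1 < s by rewrite /s; lra.
have ss : s < slope by rewrite /s; lra.
have s0 : 0 < s by apply: lt_trans Ms'.
have s1 : s < 1 := lt_trans ss (slope_lt1 B_gt1 q_gt0).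
have sM : 1 < s * M by rewrite -ltr_pdivrMr // div1r.
have [C C0 FC] := edge_map_percolation B_gt1 q_gt0 s0 ss.
have B0 : 0 < B by apply: lt_trans B_gt1.
have b1 : B^-1 ^+ C < 1 by rewrite exprn_ilt1 ?invf_lt1 ?invr_ge0 ?(ltW B0) // -lt0n.
have [x [x0 x1 bx fx]] := percolation_fixed_point s0 s1 b1 sM.
have ux n : mean n (fun y => y^-1 ^+ C) <= 1 - x.
  elim: n => [|n IH]; first by rewrite root_mean0.
  apply: le_trans (root_mean_percolation_step n (ltW s0) FC) _; apply: fx => //.
  apply: root_mean_ge0 => // y y1.
  by rewrite exprn_ge0 // invr_ge0 (le_trans ler01).
have [dl dl0 dlx] := expr_near1 C x0.
exists dl, ((1 + x) * (1 - x)); split => //.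
- by apply: mulr_ge0; lra.
- have -> : (1 + x) * (1 - x) = 1 - x * x by ring.
  by rewrite gtrBl mulr_gt0.
move=> n; apply: (@le_trans _ _ ((1 + x) * mean n (fun y => y^-1 ^+ C))).
  rewrite -root_meanZ //; apply: ler_root_mean => // y y1.
  have y0 : 0 < y by apply: lt_le_trans y1.
  case: (leP y (1 + dl)) => [yd|_]; last first.
    by rewrite mulr_ge0 ?exprn_ge0 ?invr_ge0 ?addr_ge0 ?(ltW x0) ?(ltW y0).
  rewrite exprVn ler_pdivlMr ?exprn_gt0 // mul1r; apply: le_trans dlx.
  by rewrite lerXn2r ?nnegrE ?(ltW y0) // (le_trans ler01) // (le_trans y1).
by rewrite ler_wpM2l // addr_ge0 // (ltW x0).
Qed.

Lemma near1_step n (c dl : R) : 0 <= dl -> 2%:R * dl <= B - 1 -> 2%:R <= c * slope ->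
  mean n.+1 (near1 dl) <= \sum_(k < K.+1) wt k * mean n (near1 (c * dl)) ^+ k.
Proof.
move=> dl0 dlB cs; rewrite root_meanS //; apply: ler_sum => k _.
apply: ler_wpM2l => //; have kK : (k <= K)%N by rewrite -ltnS.
rewrite -(children_mean_expr B q wt_sum n _ kK).
apply: ler_children_mean => // y y1.
case: (leP _ (1 + dl)) => [Fd|_]; last by apply: prodr_ge0 => i _.
have Xd := edge_map_expand B_gt1 q_gt0 dl0 dlB (prod_ge1 (iota 0 k) y1) Fd cs.
rewrite big1_seq // => i /= ik; suff -> : y i <= 1 + c * dl by [].
apply: le_trans Xd; rewrite (big_rem i) //=.
by rewrite ler_peMr ?prod_ge1 // (le_trans ler01).
Qed.

(** If the ratio of the root is within d of 1, those of its children are within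
    c * d of 1. On [0, t] the generating function of the offspring law is at most
    lam times the identity with lam < 1, because every vertex has a child
    and some have two; so each division of the scale d by c multiplies the
    probability by at most lam, whatever the depth. *)
Lemma near1_uniform (eta : R) : 1 < slope * \sum_(k < K.+1) k%:R * wt k ->
  \sum_(k < K.+1 | k == 1%N :> nat) wt k < 1 -> 0 < eta ->
  exists2 dl, 0 < dl & forall n, mean n (near1 dl) <= eta.
Proof.
move=> super w1lt eta0.
have [d0 [t [d00 t0 t1 tP]]] := near1_mean_lt1 super.
set w1 := \sum_(k | _) _ in w1lt.
have w10 : 0 <= w1 by apply: sumr_ge0.
have sl0 := slope_gt0 B_gt1 q_gt0.
pose c := 2%:R / slope.
have c0 : 0 < c by rewrite divr_gt0.
have cs : c * slope = 2%:R by rewrite mulfVK ?gt_eqF.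
have c1 : 1 <= c.
  rewrite ler_pdivlMr // mul1r; have := slope_lt1 B_gt1 q_gt0; lra.
pose d1 := Num.min d0 ((B - 1) / 3%:R).
have B10 : 0 < B - 1 by rewrite subr_gt0.
have d10 : 0 < d1 by rewrite lt_min d00 divr_gt0.
have d1d0 : d1 <= d0 by rewrite ge_min lexx.
have d1B : 2%:R * d1 <= B - 1.
  have : d1 <= (B - 1) / 3%:R by rewrite ge_min lexx orbT.
  lra.
have d1B' : d1 < B - 1.
  have : d1 <= (B - 1) / 3%:R by rewrite ge_min lexx orbT.
  lra.
pose d j := d1 / c ^+ j.
have d_gt0 j : 0 < d j by rewrite divr_gt0 // exprn_gt0.
have d_le j : d j <= d1.
  by rewrite ler_pdivrMr ?exprn_gt0 // ler_peMr ?(ltW d10) // exprn_ege1.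
have dS j : c * d j.+1 = d j.
  rewrite /d exprS; field.
  by rewrite expf_neq0 ?gt_eqF.
pose lam := w1 + (1 - w1) * t.
have lam0 : 0 <= lam by rewrite addr_ge0 // mulr_ge0 // subr_ge0 ltW.
have lam1 : lam < 1.
  rewrite /lam -subr_gt0; have -> : 1 - (w1 + (1 - w1) * t) = (1 - w1) * (1 - t) by ring.
  by rewrite mulr_gt0 // subr_gt0.
have genf tau : 0 <= tau -> tau <= t -> \sum_(k < K.+1) wt k * tau ^+ k <= lam * tau.
  move=> tau0 taut.
  have -> : lam * tau = w1 * tau + (1 - w1) * (tau * t) by rewrite /lam; ring.
  have -> : 1 - w1 = \sum_(k < K.+1 | ~~ (k == 1%N :> nat)) wt k.
    by rewrite -wt_sum (bigID (fun k : 'I_K.+1 => k == 1%N :> nat)) /= -/w1; ring.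
  rewrite (bigID (fun k : 'I_K.+1 => k == 1%N :> nat)) /=.
  rewrite {1}/w1 !mulr_suml; apply: lerD.
    by apply: ler_sum => k /eqP ->.
  apply: ler_sum => k k1; case: (posnP k) => [k0|k0].
    have -> : k = ord0 by apply/val_inj.
    by rewrite wt0 !mul0r.
  apply: ler_wpM2l => //; have -> : (k = k.-2.+2 :> nat).
    by case: (nat_of_ord k) k0 k1 => [|[]].
  rewrite exprS; apply: ler_wpM2l => //; rewrite exprS; apply: le_trans (taut).
  by rewrite ler_piMr // exprn_ile1 // (le_trans taut) // ltW.
have main j n : mean n (near1 (d j)) <= lam ^+ j.
  elim: j n => [|j IH] [|n]; try by rewrite expr0; apply: near1_le1.
    rewrite root_mean0; suff -> : (B <= 1 + d j.+1) = false by rewrite exprn_ge0.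
    by apply/negbTE; rewrite -ltNge -ltrBrDl (le_lt_trans (d_le _) d1B').
  have dB : 2%:R * d j.+1 <= B - 1.
    by apply: le_trans d1B; rewrite ler_pM2l.
  have cs2 : 2%:R <= c * slope by rewrite cs.
  apply: le_trans (near1_step n (ltW (d_gt0 j.+1)) dB cs2) _.
  rewrite dS; apply: le_trans (genf _ (near1_ge0 _ _) _) _.
    by apply: le_trans (tP n); apply: near1_mono; apply: le_trans (d_le j) d1d0.
  by rewrite exprS ler_wpM2l.
have [j jeta] := expr_small lam0 lam1 eta0.
by exists (d j) => // n; apply: le_trans (main j n) jeta.
Qed.

End Supercritical.

(** * The law of the truncated offspring numbers *)

Local Open Scope classical_set_scope.

Section Law.
Context (R : realType) (d : measure_display) (Omega : measurableType d).
Variables (P : probability Omega R) (mu : probability nat R).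
Variables (N : seq nat -> {RV P >-> nat}) (GW_N : GW_offspring mu N) (K : nat).

Definition trunc_env (w : Omega) : seq nat -> 'I_K.+1 :=
  fun v => inord (minn (N v w) K).

Definition trunc_law (k : 'I_K.+1) : R := fine (mu [set j | minn j K = k]).

Lemma trunc_envE w v : trunc_env w v = minn (N v w) K :> nat.
Proof. by rewrite inordK // ltnS geq_minr. Qed.

Lemma trunc_lawE (k : 'I_K.+1) : mu [set j | minn j K = k] = (trunc_law k)%:E.
Proof. by rewrite fineK // fin_num_measure. Qed.

Lemma trunc_law_ge0 k : 0 <= trunc_law k.
Proof. exact: fine_ge0. Qed.

Lemma measure_finite_partition d' (T : measurableType d') (m : probability T R)
    (X : T -> 'I_K.+1) (A : set T) : (forall k, measurable (A `&` X @^-1` [set k])) ->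
  m A = (\sum_(k : 'I_K.+1) m (A `&` X @^-1` [set k]))%E /\ measurable A.
Proof.
move=> mX; have AE : A = \big[setU/set0]_(k : 'I_K.+1) (A `&` X @^-1` [set k]).
  apply/seteqP; split => [x Ax|x].
    by rewrite -bigcup_seq; exists (X x) => //=; rewrite mem_index_enum.
  by rewrite -bigcup_seq => -[k _ []].
have mA : measurable (\big[setU/set0]_(k : 'I_K.+1) (A `&` X @^-1` [set k])).
  exact: bigsetU_measurable.
split; last by rewrite AE.
rewrite {1}AE measure_semi_additive_ord //.
by move=> i j _ _ [x [[_ <-] [_ <-]]].
Qed.

Lemma trunc_law_sum : \sum_k trunc_law k = 1.
Proof.
have [] := @measure_finite_partition _ _ mu (fun j => inord (minn j K)) setT.
  by move=> k; [].
rewrite probability_setT => e _; apply: EFin_inj; rewrite e -sumEFin.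
apply: eq_bigr => k _; rewrite -trunc_lawE setTI; congr (mu _).
apply/seteqP; split => j /=.
  by move=> jk; apply/val_inj; rewrite /= inordK // ltnS geq_minr.
by move=> <-; rewrite inordK // ltnS geq_minr.
Qed.

Lemma trunc_env_cylinder (t : seq (seq nat)) (c : seq nat -> 'I_K.+1) : uniq t ->
  measurable [set w | {in t, trunc_env w =1 c}] /\
  P [set w | {in t, trunc_env w =1 c}] = (\prod_(u <- t) trunc_law (c u))%:E.
Proof.
move=> ut; have [indep lawN] := GW_N.
pose A u := [set j : nat | minn j K = c u].
have mA u : measurable (A u) by [].
have E : [set w | {in t, trunc_env w =1 c}] = \bigcap_(u in [set` t]) (N u @^-1` A u).
  apply/seteqP; split => w /= h u ut'.
    by rewrite /A /= -trunc_envE h.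
  by apply/val_inj; rewrite /= trunc_envE; exact: h.
split.
  rewrite E bigcap_seq; apply: bigsetI_measurable => u _.
  by rewrite -[X in measurable X]setTI; exact: measurable_funPT.
rewrite E indep // -prodEFin; apply: eq_bigr => u _.
by rewrite -trunc_lawE -(lawN u).
Qed.

(** Prescribing further coordinates t is what makes the induction on s work: one
    coordinate at a time is moved from s to t. *)
Lemma trunc_env_law_cylinder (s t : seq (seq nat)) (A : (seq nat -> 'I_K.+1) -> bool)
    (c : seq nat -> 'I_K.+1) : uniq (s ++ t) -> depends_on s A ->
  measurable [set w | A (trunc_env w) /\ {in t, trunc_env w =1 c}] /\
  P [set w | A (trunc_env w) /\ {in t, trunc_env w =1 c}] =
  (wsum trunc_law s (fun e => (A e)%:R) (fun=> ord0) *
   \prod_(u <- t) trunc_law (c u))%:E.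
Proof.
elim: s t A c => [|v s IH] t A c.
  move=> /= ut dep; have [mC PC] := trunc_env_cylinder c ut.
  have AE e : A e = A (fun=> ord0) by apply: dep.
  case: (boolP (A (fun=> ord0))) => A0.
    have -> : [set w | A (trunc_env w) /\ {in t, trunc_env w =1 c}] =
        [set w | {in t, trunc_env w =1 c}].
      by apply/seteqP; split => w /=; [case | rewrite AE].
    by rewrite mul1r.
  have -> : [set w | A (trunc_env w) /\ {in t, trunc_env w =1 c}] = set0.
    by apply/seteqP; split => w //= -[]; rewrite AE (negPf A0).
  by rewrite measure0 mul0r.
rewrite cat_cons /= mem_cat negb_or => /andP[/andP[vs vt] ust] dep.
set S := [set w | _].
have slice k : S `&` (trunc_env^~ v) @^-1` [set k] =
    [set w | A (upd (trunc_env w) v k) /\ {in v :: t, trunc_env w =1 upd c v k}].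
  apply/seteqP; split => w /=.
    move=> [[Aw cw] vk]; split.
      by have -> : upd (trunc_env w) v k = trunc_env w;
        [apply/funext => u; rewrite /upd; case: eqP => // -> | ].
    move=> u; rewrite inE /upd; case: eqP => [->|_] //=; exact: cw.
  move=> [Aw cw].
  have vk : trunc_env w v = k by rewrite cw ?mem_head // /upd eqxx.
  split=> //; split.
    have <- // : upd (trunc_env w) v k = trunc_env w.
    by apply/funext => u; rewrite /upd; case: eqP => // ->.
  move=> u ut; rewrite cw ?inE ?ut ?orbT // /upd.
  by case: eqP ut vt => // -> ->.
have IHk k := IH (v :: t) (fun e => A (upd e v k)) (upd c v k).
have uk : uniq (s ++ v :: t).
  by rewrite (perm_uniq (permEl (perm_catCA s [:: v] t))) /= mem_cat negb_or vs vt.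
have [PS mS] : P S = (\sum_(k : 'I_K.+1)
    P (S `&` (trunc_env^~ v) @^-1` [set k]))%E /\ measurable S.
  apply: measure_finite_partition => k; rewrite slice.
  by have [] := IHk k uk (depends_upd k dep).
split=> //; rewrite PS mulr_suml -sumEFin; apply: eq_bigr => k _.
rewrite slice; have [_ ->] := IHk k uk (depends_upd k dep).
congr EFin; rewrite big_cons; have -> : upd c v k v = k by rewrite /upd eqxx.
rewrite mulrA [_ * trunc_law k]mulrC wsum_upd //; congr (_ * _ * _).
rewrite big_seq [in RHS]big_seq; apply: eq_bigr => u ut; rewrite /upd.
by case: eqP ut vt => // -> ->.
Qed.
Lemma trunc_env_law (s : seq (seq nat)) (A : (seq nat -> 'I_K.+1) -> bool) :
  uniq s -> depends_on s A ->
  measurable [set w | A (trunc_env w)] /\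
  P [set w | A (trunc_env w)] =
  (wsum trunc_law s (fun e => (A e)%:R) (fun=> ord0))%:E.
Proof.
move=> us dep; have us0 : uniq (s ++ [::]) by rewrite cats0.
have [] := trunc_env_law_cylinder (fun=> ord0) us0 dep; rewrite big_nil mulr1.
have -> // : [set w | A (trunc_env w) /\ {in [::], trunc_env w =1 fun=> ord0}] =
  [set w | A (trunc_env w)].
by apply/seteqP; split => w /=; [case | split].
Qed.

Lemma ratio_law (B q : R) n (Q : pred R) :
  measurable [set w | Q (ratio B q n [::] (trunc_env w))] /\
  P [set w | Q (ratio B q n [::] (trunc_env w))] =
  (root_mean B q trunc_law n (fun y => (Q y)%:R))%:E.
Proof.
have dep : depends_on (ratio_words K n [::])
    (fun e : seq nat -> 'I_K.+1 => Q (ratio B q n [::] e)).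
  by move=> e e' /depends_ratio ->.
exact: trunc_env_law (uniq_ratio_words K n [::]) dep.
Qed.

End Law.

Section TruncatedMean.
Context (R : realType) (mu : probability nat R) (m : R).
Hypotheses (mu0 : mu [set 0%N] = 0%E) (mu1 : (mu [set 1%N] < 1)%E).
Hypothesis mean_mu : ('E_mu[fun k : nat => k%:R%R] = m%:E)%E.

Lemma integral_min (K : nat) :
  (\int[mu]_j ((minn j K)%:R)%:E)%E = (\sum_(k < K.+1) k%:R * trunc_law mu k)%:E.
Proof.
pose S (k : 'I_K.+1) := [set j | minn j K = k].
have minE j : (((minn j K)%:R : R)%:E = \sum_(k : 'I_K.+1) (k%:R * \1_(S k) j)%:E)%E.
  have jK : (minn j K < K.+1)%N by rewrite ltnS geq_minr.
  rewrite (bigD1 (Ordinal jK)) //= indicE mem_set // mulr1.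
  rewrite big1 ?adde0 // => k kj; rewrite indicE memNset ?mulr0 // => jk.
  by case/eqP: kj; apply/val_inj; rewrite /= -jk.
under eq_integral => j _ do rewrite minE.
rewrite ge0_integral_sum; [|by []..|by move=> k j _; rewrite lee_fin mulr_ge0].
rewrite -sumEFin; apply: eq_bigr => k _.
under eq_integral => j _ do rewrite EFinM.
rewrite ge0_integralZl_EFin //.
by rewrite integral_indic // setIT EFinM; congr (_ * _)%E; exact: trunc_lawE.
Qed.

Lemma mean_integral : (\int[mu]_j (j%:R)%:E)%E = m%:E.
Proof. by rewrite -mean_mu unlock. Qed.

Lemma trunc_mean_le (K : nat) : \sum_(k < K.+1) k%:R * trunc_law mu k <= m.
Proof.
rewrite -lee_fin -integral_min -mean_integral; apply: ge0_le_integral => //.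
by move=> j _; rewrite lee_fin ler_nat geq_minl.
Qed.

(** Monotone convergence in the truncation level. *)
Lemma trunc_mean_cvg (x : R) : x < m ->
  exists K, (1 < K)%N /\ x < \sum_(k < K.+1) k%:R * trunc_law mu k.
Proof.
move=> xm.
pose g (K j : nat) : \bar R := ((minn j K)%:R)%:E.
have gcvg : (\int[mu]_j g K j)%E @[K --> \oo] --> (\int[mu]_j (j%:R)%:E)%E.
  have -> : (fun j : nat => (j%:R : R)%:E) = (fun j => limn (g ^~ j)).
    apply/funext => j; apply/esym/cvg_lim => //.
    apply: cvg_near_cst; near=> K.
    by rewrite /g (minn_idPl _) //; near: K; exists j.
  apply: cvg_monotone_convergence => //.
  - by move=> K j _; rewrite lee_fin.
  - by move=> j _ a b ab; rewrite lee_fin ler_nat leq_min geq_minl (leq_trans (geq_minr _ _) ab).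
apply: contrapT => nK; have : (m%:E <= x%:E)%E; last by rewrite lee_fin leNgt xm.
rewrite -mean_integral; apply: cvge_le gcvg; exists 2%N => // K /= K1.
rewrite integral_min lee_fin leNgt; apply/negP => xK.
by apply: nK; exists K.
Unshelve. all: by end_near. Qed.

Section Weights.
Variable K : nat.
Hypothesis K_gt1 : (1 < K)%N.
Local Notation mu_1 := (fine (mu [set 1%N])).

Lemma trunc_law0 : trunc_law mu (ord0 : 'I_K.+1) = 0.
Proof.
rewrite /trunc_law; suff -> : [set j | minn j K = (ord0 : 'I_K.+1)] = [set 0%N].
  by rewrite mu0.
apply/seteqP; split => j /=; last by move=> ->; rewrite min0n.
by rewrite /minn; case: ltnP => // _ K0; move: K_gt1; rewrite K0.
Qed.

Lemma trunc_law1 : \sum_(k < K.+1 | k == 1%N :> nat) trunc_law mu k = mu_1.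
Proof.
have K1 : (1 < K.+1)%N by exact: ltnW.
rewrite (big_pred1 (Ordinal K1)) // /trunc_law; congr (fine (mu _)).
apply/seteqP; split => j /=; last by move=> ->; apply/minn_idPl/ltnW.
by rewrite /minn; case: ltnP => // _ K0; move: K_gt1; rewrite K0.
Qed.

Lemma mu_1_lt1 : mu_1 < 1.
Proof. by rewrite -lte_fin fineK ?fin_num_measure. Qed.

Lemma trunc_law_ge2 : \sum_(k < K.+1) (1 < k)%N%:R * trunc_law mu k = 1 - mu_1.
Proof.
rewrite -[in RHS](trunc_law_sum mu K) -trunc_law1.
rewrite [X in X - _](bigID (fun k : 'I_K.+1 => k == 1%N :> nat)) /= [RHS]addrC addKr.
rewrite [RHS]big_mkcond /=; apply: eq_bigr => k _.
case: (eqVneq (k : nat) 1%N) => [->|k1] /=; first by rewrite mul0r.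
case: (ltnP 1 k) => [_|k_le1]; first by rewrite mul1r.
have -> : k = ord0 by apply/val_inj/eqP; rewrite -leqn0 -ltnS ltn_neqAle k1.
by rewrite trunc_law0 mulr0.
Qed.

(** Every vertex has a child, and with probability 1 - mu_1 at least two. *)
Lemma mean_gt1 : 1 < m.
Proof.
apply: lt_le_trans (trunc_mean_le K); apply: (@lt_le_trans _ _ (1 + (1 - mu_1))).
  by rewrite ltrDl subr_gt0 mu_1_lt1.
rewrite -trunc_law_ge2 -{1}(trunc_law_sum mu K) -big_split /=.
apply: ler_sum => k _; rewrite -{1}[trunc_law mu k]mul1r -mulrDl.
case: (posnP k) => [k0|k0].
  have -> : k = ord0 by apply/val_inj.
  by rewrite trunc_law0 !mulr0.
apply: ler_wpM2r; first exact: trunc_law_ge0.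
case: (nat_of_ord k) k0 => [|[|j]] // _; first by rewrite addr0.
by rewrite -[1 + 1]/(2%:R) ler_nat.
Qed.

End Weights.

End TruncatedMean.

(** * Removing the truncation *)

(** Only finitely many vertices are visited, so a large K truncates none of them. *)
Lemma edge_ratio_trunc (R : fieldType) (B q : R) (N : seq nat -> nat) n v :
  exists K0, forall K, (K0 <= K)%N ->
    edge_ratio B q (fun u => minn (N u) K) n v = edge_ratio B q N n v.
Proof.
elim: n v => [|n IH] v; first by exists 0%N.
have /choice[f fP] : forall i, exists K0, forall K, (K0 <= K)%N ->
    edge_ratio B q (fun u => minn (N u) K) n (i :: v) = edge_ratio B q N n (i :: v).
  by move=> i; exact: IH.
exists (maxn (N v) (\max_(i <- iota 0 (N v)) f i)) => K.
rewrite geq_max => /andP[vK fK] /=; rewrite (minn_idPl vK); congr edge_map.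
apply: eq_big_seq => i iv; apply: fP; apply: leq_trans fK.
by rewrite (big_rem i) //= leq_maxl.
Qed.

Section RootRatio.
Context (R : realType) (d : measure_display) (Omega : measurableType d).
Variables (P : probability Omega R) (mu : probability nat R).
Variables (N : seq nat -> {RV P >-> nat}) (m B q : R).
Hypotheses (mu0 : mu [set 0%N] = 0%E) (mu1 : (mu [set 1%N] < 1)%E).
Hypothesis mean_mu : ('E_mu[fun k : nat => k%:R%R] = m%:E)%E.
Hypotheses (GW_N : GW_offspring mu N) (B_gt1 : 1 < B) (q_gt0 : 0 < q).
Local Notation slope := ((B - 1) / (B + q - 1)).

Definition root_ratio (n : nat) (w : Omega) : R :=
  edge_ratio B q (fun u => N u w) n [::].

Definition trunc_ratio (K n : nat) (w : Omega) : R :=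
  ratio B q n [::] (trunc_env N K w).

Lemma trunc_ratioE K n w :
  trunc_ratio K n w = edge_ratio B q (fun u => minn (N u w) K) n [::].
Proof.
rewrite /trunc_ratio /ratio; congr edge_ratio; apply/funext => u.
exact: trunc_envE.
Qed.

Lemma trunc_ratio_le K n w : trunc_ratio K n w <= root_ratio n w.
Proof. by rewrite trunc_ratioE; apply: edge_ratio_mono => // u; exact: geq_minl. Qed.

Lemma trunc_ratio_mono n w :
  {homo (fun K => trunc_ratio K n w) : K L / (K <= L)%N >-> K <= L}.
Proof.
move=> K L KL; rewrite !trunc_ratioE; apply: edge_ratio_mono => // u.
by rewrite leq_min geq_minl (leq_trans (geq_minr _ _) KL).
Qed.

Lemma trunc_ratio_eventually n w :
  exists K0, forall K, (K0 <= K)%N -> trunc_ratio K n w = root_ratio n w.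
Proof.
have [K0 K0P] := edge_ratio_trunc B q (fun u => N u w) n [::].
by exists K0 => K KK; rewrite trunc_ratioE K0P.
Qed.

Lemma measurable_root_ratio n (Q : pred R) :
  measurable [set w | Q (root_ratio n w)].
Proof.
have -> : [set w | Q (root_ratio n w)] =
    \bigcup_K0 \bigcap_(K in [set K | (K0 <= K)%N]) [set w | Q (trunc_ratio K n w)].
  apply/seteqP; split => w /=.
    have [K0 K0P] := trunc_ratio_eventually n w.
    by move=> Qw; exists K0 => // K /= KK; rewrite K0P.
  case=> K0 _ QK; have [K1 K1P] := trunc_ratio_eventually n w.
  by rewrite -(K1P (maxn K0 K1)) ?leq_maxr //; apply: QK; exact: leq_maxl.
apply: bigcup_measurable => K0 _; apply: bigcap_measurable; first by exists K0 => /=.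
by move=> K _; have [] := ratio_law GW_N K B q n Q.
Qed.

(** The event for the full tree is the increasing union of the events for the
    truncated trees. *)
Lemma root_ratio_high n (c b : R) :
  (forall K, (1 < K)%N -> (P [set w | (c <= trunc_ratio K n w)%R] <= b%:E)%E) ->
  (P [set w | (c <= root_ratio n w)%R] <= b%:E)%E.
Proof.
move=> bound; pose F K := [set w | (c <= trunc_ratio K.+2 n w)%R].
have mF K : measurable (F K).
  by have [] := ratio_law GW_N K.+2 B q n (fun y => c <= y).
have FE : [set w | (c <= root_ratio n w)%R] = \bigcup_K F K.
  apply/seteqP; split => w /=.
    have [K0 K0P] := trunc_ratio_eventually n w => cw.
    by exists K0 => //; rewrite /F /= K0P // -addn2 leq_addr.
  by case=> K _; rewrite /F /= => /le_trans; apply; exact: trunc_ratio_le.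
have cv : P \o F @ \oo --> P (\bigcup_K F K).
  apply: nondecreasing_cvg_mu => //; first exact: bigcup_measurable.
  move=> K L KL; apply/subsetPset => w; rewrite /F /= => /le_trans; apply.
  by apply: trunc_ratio_mono; rewrite !ltnS.
rewrite FE; apply: cvge_le cv.
by apply: nearW => K; exact: bound.
Qed.

(** The truncated mean offspring is at most m, so all the truncated trees decay at
    a common speed. *)
Lemma root_ratio_subcritical (dl eta : R) : q <= 2%:R -> slope * m <= 1 ->
  0 < dl -> 0 < eta ->
  exists n0, forall n, (n0 <= n)%N ->
    (P [set w | (1 + dl <= root_ratio n w)%R] <= eta%:E)%E.
Proof.
move=> q2 crit dl0 eta0; have sl0 := slope_gt0 B_gt1 q_gt0.
pose c := slope * (1 - fine (mu [set 1%N])) / 2%:R.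
have c0 : 0 < c by rewrite divr_gt0 // mulr_gt0 // subr_gt0 mu_1_lt1.
pose eps := eta * dl / (2%:R + dl).
have dl2 : 0 < 2%:R + dl by rewrite addr_gt0.
have eps0 : 0 < eps by rewrite divr_gt0 // mulr_gt0.
have ce0 : 0 < c * eps ^+ 3 by rewrite mulr_gt0 // exprn_gt0.
exists (Num.trunc ((c * eps ^+ 3)^-1)).+1 => n n0.
have large : 1 <= n%:R * (c * eps ^+ 3).
  rewrite -ler_pdivrMr // div1r; apply/ltW; apply: lt_le_trans (truncnS_gt _) _.
  by rewrite ler_nat.
apply: root_ratio_high => K K1.
have [_ ->] := ratio_law GW_N K B q n (fun y => 1 + dl <= y).
have wt0 := @trunc_law_ge0 R mu K; have wt1 := trunc_law_sum mu K.
rewrite lee_fin; apply: le_trans (root_mean_markov B_gt1 q_gt0 wt0 n dl0) _.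
have crit' : slope * \sum_(k < K.+1) k%:R * trunc_law mu k <= 1.
  apply: le_trans crit; apply: ler_wpM2l; first exact: ltW.
  exact: trunc_mean_le.
have cc : c <= slope * (\sum_(k < K.+1) (1 < k)%N%:R * trunc_law mu k) / 2%:R.
  by rewrite trunc_law_ge2.
have ln := half_tanh_mean_decay B_gt1 q_gt0 q2 wt0 wt1 K1 crit' (ltW c0) cc eps0 large.
apply: le_trans (ler_wpM2l _ ln) _; first by rewrite divr_ge0 // ltW.
by rewrite le_eqVlt; apply/orP; left; apply/eqP; rewrite /eps; field; rewrite !gt_eqF.
Qed.

(** A truncated tree with mean still above the inverse of the slope is contained in
    the full tree, and its ratios are smaller. *)
Lemma root_ratio_supercritical (eta : R) : 1 < slope * m -> 0 < eta ->
  exists2 dl, 0 < dl & forall n,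
    (P [set w | (root_ratio n w <= 1 + dl)%R] <= eta%:E)%E.
Proof.
move=> super eta0; have sl0 := slope_gt0 B_gt1 q_gt0.
have sm : slope^-1 < m by rewrite -(ltr_pM2l sl0) divff ?gt_eqF.
have [K [K1 MK]] := trunc_mean_cvg mean_mu sm.
have super' : 1 < slope * \sum_(k < K.+1) k%:R * trunc_law mu k.
  by rewrite -(ltr_pM2l sl0) divff ?gt_eqF // in MK.
have wt0 := @trunc_law_ge0 R mu K; have wt1 := trunc_law_sum mu K.
have w1lt : \sum_(k < K.+1 | k == 1%N :> nat) trunc_law mu k < 1.
  by rewrite trunc_law1 // mu_1_lt1.
have [dl dl0 dlP] :=
  near1_uniform B_gt1 q_gt0 wt0 wt1 (trunc_law0 mu0 K1) super' w1lt eta0.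
exists dl => // n.
have [mA PA] := ratio_law GW_N K B q n (fun y => y <= 1 + dl).
apply: (@le_trans _ _ (P [set w | (trunc_ratio K n w <= 1 + dl)%R])).
  apply: le_measure; rewrite ?inE //.
    exact: (measurable_root_ratio n (fun y => y <= 1 + dl)).
  by move=> w /=; apply: le_trans; exact: trunc_ratio_le.
by rewrite PA lee_fin.
Qed.

End RootRatio.

(** * From the ratio to the connection probability *)

Section Transfer.
Context (R : realType) (q beta : R).
Hypotheses (q_gt0 : 0 < q) (beta_gt0 : 0 < beta).
Local Notation B := (expR beta).
Implicit Type N : seq nat -> nat.

Let B_gt1 : 1 < B. Proof. by rewrite expR_gt1. Qed.

Lemma psi_gt0 : 0 < psi q beta.
Proof. exact: slope_gt0. Qed.

Lemma conn_prob_ge0 N n : 0 <= conn_prob N q beta n.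
Proof.
have Y1 := edge_ratio_ge1 B_gt1 q_gt0 N n [::].
rewrite conn_probE // mulr_ge0 ?invr_ge0 ?(ltW psi_gt0) // divr_ge0 ?subr_ge0 //.
by rewrite addr_ge0 ?(ltW q_gt0) // subr_ge0.
Qed.

Lemma conn_prob_antimono N n : conn_prob N q beta n.+1 <= conn_prob N q beta n.
Proof.
rewrite !conn_probE // ler_pM2l ?invr_gt0 ?psi_gt0 //.
have := edge_ratio_ge1 B_gt1 q_gt0 N n.+1 [::].
have := edge_ratio_antimono B_gt1 q_gt0 N n [::].
move: (edge_ratio _ _ _ n _) (edge_ratio _ _ _ _ _) => y y' yy y1.
have q0 := q_gt0; have D : 0 < y - 1 + q by lra.
have D' : 0 < y' - 1 + q by lra.
rewrite ler_pdivrMr // mulrAC ler_pdivlMr // -subr_ge0.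
have -> : (y - 1) * (y' - 1 + q) - (y' - 1) * (y - 1 + q) = (y - y') * q by ring.
by rewrite mulr_ge0 ?subr_ge0 // ltW.
Qed.

Lemma conn_prob_is_cvg N : cvgn (conn_prob N q beta).
Proof.
apply: nonincreasing_is_cvgn.
  by apply/nonincreasing_seqP => n; exact: conn_prob_antimono.
by exists 0 => _ [n _ <-]; exact: conn_prob_ge0.
Qed.

Lemma conn_prob_high N n (eps : R) : eps <= conn_prob N q beta n ->
  1 + q * psi q beta * eps <= edge_ratio B q N n [::].
Proof.
rewrite conn_probE // [_^-1 * _]mulrC ler_pdivlMr ?psi_gt0 //.
have Y1 := edge_ratio_ge1 B_gt1 q_gt0 N n [::].
move: (edge_ratio _ _ _ n _) Y1 => y y1 le.
rewrite -lerBrDl -mulrA [psi _ _ * _]mulrC.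
apply: le_trans (ler_wpM2l (ltW q_gt0) le) _.
rewrite mulrA ler_pdivrMr; last by have := q_gt0; lra.
rewrite mulrC ler_wpM2l ?subr_ge0 //; lra.
Qed.

Lemma conn_prob_low N n (eps : R) : conn_prob N q beta n <= eps ->
  edge_ratio B q N n [::] <= 1 + (B - 1) * eps.
Proof.
rewrite conn_probE //.
have Y1 := edge_ratio_ge1 B_gt1 q_gt0 N n [::].
have YB := edge_ratio_leB B_gt1 q_gt0 N n [::].
move: (edge_ratio _ _ _ n _) Y1 YB => y y1 yB le.
have B1 := B_gt1; have q0 := q_gt0.
rewrite -lerBlDl; apply: le_trans (ler_wpM2l _ le); last by rewrite subr_ge0 ltW.
have -> : (B - 1) * ((psi q beta)^-1 * ((y - 1) / (y - 1 + q))) =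
    (y - 1) * ((B + q - 1) / (y - 1 + q)).
  by rewrite /psi; field; rewrite !gt_eqF //; lra.
rewrite ler_peMr ?subr_ge0 // ler_pdivlMr; lra.
Qed.

Lemma conn_prob_measurable (d : measure_display) (Omega : measurableType d)
    (P : probability Omega R) (mu : probability nat R)
    (N : seq nat -> {RV P >-> nat}) n (Q : pred R) : GW_offspring mu N ->
  measurable [set w : Omega | Q (conn_prob (fun v => N v w) q beta n)].
Proof.
move=> GW_N; have := measurable_root_ratio B q GW_N n
  (fun y => Q ((psi q beta)^-1 * ((y - 1) / (y - 1 + q)))).
have -> // : [set w : Omega | Q (conn_prob (fun v => N v w) q beta n)] =
  [set w : Omega | Q ((psi q beta)^-1 *
     ((root_ratio N B q n w - 1) / (root_ratio N B q n w - 1 + q)))].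
by apply/seteqP; split => w /=; rewrite conn_probE.
Qed.

(** Both sides say that expR beta * (m - 1) <= q + m - 1, with equality at
    beta_c. *)
Lemma slope_critical (m beta_c : R) : 1 < m -> m * psi q beta_c = 1 ->
  (psi q beta * m <= 1) = (beta <= beta_c).
Proof.
move=> m1 bc; have m10 : 0 < m - 1 by rewrite subr_gt0.
have nz : expR beta_c + q - 1 != 0.
  apply/eqP => z; move: bc; rewrite /psi z invr0 !mulr0 => /eqP.
  by rewrite eq_sym oner_eq0.
have bcE : m * (expR beta_c - 1) = expR beta_c + q - 1.
  have := congr1 ( *%R^~ (expR beta_c + q - 1)) bc.
  by rewrite /= mul1r /psi -mulrA mulfVK.
have den : 0 < B + q - 1 by have := B_gt1; have := q_gt0; lra.
rewrite /psi mulrAC ler_pdivrMr // mul1r -[in RHS]ler_expR -[in RHS](ler_pM2r m10).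
by apply/idP/idP => h; lra.
Qed.

End Transfer.

Lemma cvge0_le (R : realType) (T : Type) (F : set_system T) (u : T -> \bar R) :
  Filter F -> (forall t, 0 <= u t)%E ->
  (forall eta : R, 0 < eta -> \forall t \near F, (u t <= eta%:E)%E) ->
  u @ F --> 0%E.
Proof.
move=> FF u0 ule.
have fin t (eta : R) : (u t <= eta%:E)%E -> u t \is a fin_num.
  by move=> h; rewrite ge0_fin_numE // (le_lt_trans h) ?ltry.
apply/fine_cvgP; split.
  by near=> t; apply: (@fin t 1); near: t; exact: ule.
apply/cvgrPdist_le => e e0; near=> t.
have ue : (u t <= e%:E)%E by near: t; exact: ule.
by rewrite /= sub0r normrN ger0_norm ?fine_ge0 // -lee_fin fineK // (fin t e).
Unshelve. all: by end_near. Qed.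

Section Events.
Context (R : realType) (d : measure_display) (Omega : measurableType d).
Variable (P : probability Omega R).

Lemma negligible_le_all (A : set Omega) :
  (forall eta : R, 0 < eta -> exists2 C, measurable C /\ A `<=` C & (P C <= eta%:E)%E) ->
  P.-negligible A.
Proof.
move=> AC; have /choice[C CP] : forall j : nat, exists C,
    [/\ measurable C, A `<=` C & (P C <= (j.+1%:R^-1)%:E)%E].
  move=> j; have [|C [mC sC] PC] := AC j.+1%:R^-1; first by rewrite invr_gt0 ltr0n.
  by exists C.
exists (\bigcap_j C j); split.
- by apply: bigcap_measurable => [|j _]; [exists 0%N | case: (CP j)].
- apply/eqP; rewrite -measure_le0; apply/lee_addgt0Pr => e e0; rewrite add0e.
  pose j := Num.trunc e^-1.
  apply: (@le_trans _ _ (P (C j))).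
    apply: le_measure; rewrite ?inE; last by apply: bigcap_inf.
      by apply: bigcap_measurable => [|i _]; [exists 0%N | case: (CP i)].
    by case: (CP j).
  have [_ _ /le_trans] := CP j; apply; rewrite lee_fin invf_ple ?posrE ?ltr0n //.
  exact/ltW/truncnS_gt.
- by move=> w Aw j _; case: (CP j) => _ sC _; exact: sC.
Qed.

Lemma le_measure_incr (F : nat -> set Omega) (b : R) :
  (forall n, measurable (F n)) -> nondecreasing_seq F ->
  (forall n, P (F n) <= b%:E)%E -> (P (\bigcup_n F n) <= b%:E)%E.
Proof.
move=> mF ndF Fb; have mU : measurable (\bigcup_n F n) by exact: bigcup_measurable.
have cv := nondecreasing_cvg_mu (mu := P) mF mU ndF.
by apply: cvge_le cv; apply: nearW.
Qed.

End Events.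

Lemma limn_esup_le_cst (R : realType) (u : nat -> \bar R) (c : \bar R) :
  (forall n, u n <= c)%E -> (limn_esup u <= c)%E.
Proof.
move=> uc; rewrite /limn_esup limf_esupE.
apply: (@le_trans _ _ (ereal_sup (u @` setT))).
  by apply: ereal_inf_lbound; exists setT => //; exact: filterT.
by apply: ge_ereal_sup => _ [n _ <-].
Qed.

Lemma limn_esup_ge0 (R : realType) (u : nat -> \bar R) :
  (forall n, 0 <= u n)%E -> (0 <= limn_esup u)%E.
Proof. by move=> u0; apply: limf_esup_ge0 => //; exact: filter_not_empty. Qed.

(** * The phase transition *)

Theorem theorem2p4 (R : realType) (d : measure_display)
    (Omega : measurableType d) (P : probability Omega R)
    (mu : probability nat R) (N : seq nat -> {RV P >-> nat}) (m q beta_c : R)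
    (mu0 : mu [set 0%N] = 0%E) (mu1 : (mu [set 1%N] < 1)%E)
    (mean_mu : ('E_mu[fun k : nat => k%:R%R] = m%:E)%E)
    (GW_N : GW_offspring mu N)
    (q_gt0 : 0 < q) (q_le2 : q <= 2)
    (beta_cE : m * psi q beta_c = 1) :
  let pi_ (beta : R) (n : nat) (w : Omega) : R :=
    conn_prob (fun v => N v w) q beta n in
  forall beta : R, 0 < beta ->
  [/\ beta <= beta_c -> cvg_in_probability P (pi_ beta) 0,
      beta_c < beta -> liminf_gt0_in_probability P (pi_ beta),
      {ae P, forall w, cvgn (fun n => pi_ beta n w)} &
      {ae P, forall w,
        0 < limn (fun n => pi_ beta n w) <-> beta_c < beta}].
Proof.
move=> pi_ beta beta0.
have B1 : 1 < expR beta by rewrite expR_gt1.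
have psi0 : 0 < psi q beta by exact: psi_gt0.
have m1 : 1 < m by exact: (mean_gt1 mu0 mu1 mean_mu (K := 2)).
have crit := slope_critical q_gt0 beta0 m1 beta_cE.
have mpi n (Q : pred R) : measurable [set w | Q (pi_ beta n w)].
  exact: (conn_prob_measurable q_gt0 beta0 n Q GW_N).
have pi0 n w : 0 <= pi_ beta n w by exact: conn_prob_ge0.
have pi_cvg w : cvgn (fun n => pi_ beta n w) by exact: conn_prob_is_cvg.
have pi_decr w : nonincreasing_seq (fun n => pi_ beta n w).
  by apply/nonincreasing_seqP => n; exact: conn_prob_antimono.
have lim_le w n : limn (fun k => pi_ beta k w) <= pi_ beta n w.
  exact: nonincreasing_cvgn_ge.
have sub eps eta : beta <= beta_c -> 0 < eps -> 0 < eta ->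
    exists n0, forall n, (n0 <= n)%N ->
      (P [set w | (eps <= pi_ beta n w)%R] <= eta%:E)%E.
  move=> bc eps0 eta0.
  have [||n0 n0P] := root_ratio_subcritical mu0 mu1 mean_mu GW_N B1 q_gt0
    (dl := q * psi q beta * eps) q_le2 _ _ eta0.
  - by rewrite -/(psi q beta) crit.
  - by apply: mulr_gt0 => //; exact: mulr_gt0.
  exists n0 => n nn; apply: le_trans (n0P n nn); apply: le_measure; rewrite ?inE //.
  - exact: (measurable_root_ratio (expR beta) q GW_N n
      (fun y => 1 + q * psi q beta * eps <= y)).
  - by move=> w /=; exact: conn_prob_high.
have super eta : beta_c < beta -> 0 < eta ->
    exists2 e0, 0 < e0 & forall n eps, eps <= e0 ->
      (P [set w | (pi_ beta n w <= eps)%R] <= eta%:E)%E.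
  move=> bc eta0.
  have [|dl dl0 dlP] := root_ratio_supercritical mu0 mu1 mean_mu GW_N B1 q_gt0 _ eta0.
    by rewrite -/(psi q beta) ltNge crit -ltNge.
  have B10 : 0 < expR beta - 1 by rewrite subr_gt0.
  exists (dl / (expR beta - 1)) => [|n eps]; first by rewrite divr_gt0.
  rewrite ler_pdivlMr // mulrC => le_dl.
  apply: le_trans (dlP n); apply: le_measure; rewrite ?inE //.
  - exact: (mpi n (fun y => y <= eps)).
  - exact: (measurable_root_ratio (expR beta) q GW_N n (fun y => y <= 1 + dl)).
  - move=> w /= /(conn_prob_low q_gt0 beta0) /le_trans; apply.
    by rewrite lerD2l.
split.
- move=> bc eps eps0; apply: cvge0_le => // eta eta0.
  have [n0 n0P] := sub eps eta bc eps0 eta0.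
  exists n0 => // n /= nn.
  under eq_set => w do rewrite subr0 ger0_norm //.
  exact: n0P.
- move=> bc; apply: cvge0_le => [eps|eta eta0]; first exact: limn_esup_ge0.
  have [e0 e00 e0P] := super eta bc eta0.
  near=> eps; apply: limn_esup_le_cst => n; apply: e0P.
  by near: eps; exact: nbhs_right_le.
- exact: aeW.
- case: (leP beta beta_c) => bc.
    apply: (negligibleS (A := \bigcup_j
        [set w | j.+1%:R^-1 <= limn (fun n => pi_ beta n w)])).
      move=> w /= nw; have l0 : 0 < limn (fun n => pi_ beta n w).
        by rewrite ltNge; apply/negP => l0; apply: nw; split => //; rewrite ltNge l0.
      exists (Num.trunc (limn (fun n => pi_ beta n w))^-1) => //=.
      by rewrite invf_ple ?posrE ?ltr0n //; exact/ltW/truncnS_gt.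
    apply: negligible_bigcup => j; apply: negligible_le_all => eta eta0.
    have j0 : 0 < j.+1%:R^-1 :> R by rewrite invr_gt0.
    have [n0 n0P] := sub j.+1%:R^-1 eta bc j0 eta0.
    exists [set w | j.+1%:R^-1 <= pi_ beta n0 w]; last exact: n0P.
    split; first exact: (mpi n0 (fun y => j.+1%:R^-1 <= y)).
    by move=> w /= /le_trans; apply; exact: lim_le.
  apply: negligible_le_all => eta eta0.
  have [e0 e00 e0P] := super eta bc eta0.
  exists (\bigcup_n [set w | pi_ beta n w <= e0]).
    split; first by apply: bigcup_measurable => n _; exact: (mpi n (fun y => y <= e0)).
    move=> w /= nw; have l0 : limn (fun n => pi_ beta n w) <= 0.
      by rewrite leNgt; apply/negP => l0; apply: nw.
    apply: contrapT => small; suff : e0 <= limn (fun n => pi_ beta n w).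
      by rewrite leNgt (le_lt_trans l0).
    apply: limr_ge => //; apply: nearW => n; rewrite leNgt; apply/negP => /ltW le_e0.
    by apply: small; exists n.
  apply: le_measure_incr => [n|a b ab|n]; last exact: e0P.
    exact: (mpi n (fun y => y <= e0)).
  by apply/subsetPset => w /=; apply: le_trans; exact: pi_decr.
Unshelve. all: by end_near. Qed.
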